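(* Let $R>0$ and $\gamma>1$ be constants, and let $\tau(\theta),\mu(\theta),\kappa(\theta)$ be any positive $C^2$ functions of $\theta\in\mathbb{R}^+$. For a given left-end state $(v_-,u_-,\theta_-)\in\mathbb{R}^+\times\mathbb{R}\times\mathbb{R}^+$ there exist constants $\varepsilon_0,C>0$ such that the following holds for every right-end state $(v_+,u_+,\theta_+)\in\mathbb{R}^+\times\mathbb{R}\times\mathbb{R}^+$ which satisfies, together with the left-end state, the Rankine–Hugoniot and Lax conditions stated in the context (for a 1-shock or for a 3-shock), and for which $\varepsilon:=|v_--v_+|\in(0,\varepsilon_0)$. Let $(\tilde v_\varepsilon,\tilde u_\varepsilon,\tilde\theta_\varepsilon)$ be the monotone solution of the profile ODE problem in the context with $\tilde v_\varepsilon(0)=\frac{v_-+v_+}{2}$, let $\sigma_*$ be as in the context, and define the constant $A>0$ by $$A:=\frac{R\gamma\sigma_*}{R\tau(\theta_-)+R\gamma\mu(\theta_-)+(\gamma-1)^2\kappa(\theta_-)}\cdot\frac{\gamma+1}{2}.$$ Then, for $y(\xi):=(\tilde v_\varepsilon(\xi)-v_-)/\varepsilon$, it holds that $$\left|\frac{1}{y(1-y)}\frac{dy}{d\xi}-A\varepsilon\right|\le C\varepsilon^2 .$$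
   Context: Notation: $\mathbb{R}^+=(0,\infty)$. The pressure is $p(v,\theta)=R\theta/v$, and the total energy is $E=\frac{R}{\gamma-1}\theta+\frac{u^2}{2}$. Write $p_\pm=p(v_\pm,\theta_\pm)$ and $E_\pm=\frac{R}{\gamma-1}\theta_\pm+\frac{u_\pm^2}{2}$. Rankine–Hugoniot and Lax conditions: there exists $\sigma\in\mathbb{R}$ such that $$-\sigma(v_+-v_-)-(u_+-u_-)=0,\quad -\sigma(u_+-u_-)+p_+-p_-=0,\quad -\sigma(E_+-E_-)+p_+u_+-p_-u_-=0,$$ and either $v_->v_+$, $u_->u_+$, $\theta_-<\theta_+$ (1-shock) or $v_-<v_+$, $u_->u_+$, $\theta_->\theta_+$ (3-shock) holds. Shock speeds: for a 1-shock, $$\sigma_\varepsilon:=-\sqrt{-\frac{p_+-p_-}{v_+-v_-}},\qquad \sigma_*:=-\sqrt{\frac{\gamma p_-}{v_-}}=-\frac{\sqrt{\gamma R\theta_-}}{v_-};$$ for a 3-shock, $$\sigma_\varepsilon:=\sqrt{-\frac{p_+-p_-}{v_+-v_-}},\qquad \sigma_*:=\sqrt{\frac{\gamma p_-}{v_-}}=\frac{\sqrt{\gamma R\theta_-}}{v_-}.$$ Profile ODE problem (traveling waves, in the variable $\xi=x-\sigma t$, of the one-dimensional Brenner–Navier–Stokes–Fourier system in Lagrangian mass coordinates): find $(\tilde v,\tilde u,\tilde\theta):\mathbb{R}\to\mathbb{R}^+\times\mathbb{R}\times\mathbb{R}^+$ with $\sigma=\sigma_\varepsilon$ and (writing $'=d/d\xi$)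 $$-\sigma\tilde v'-\tilde u'=\Big(\tau(\tilde\theta)\frac{\tilde v'}{\tilde v}\Big)',\qquad -\sigma\tilde u'+p(\tilde v,\tilde\theta)'=\Big(\mu(\tilde\theta)\frac{\tilde u'}{\tilde v}\Big)',$$ $$-\sigma\Big(\frac{R}{\gamma-1}\tilde\theta+\frac{\tilde u^2}{2}\Big)'+(p(\tilde v,\tilde\theta)\tilde u)'=\Big(\kappa(\tilde\theta)\frac{\tilde\theta'}{\tilde v}\Big)'+\Big(\mu(\tilde\theta)\frac{\tilde u\tilde u'}{\tilde v}\Big)',$$ $$\lim_{\xi\to\pm\infty}(\tilde v,\tilde u,\tilde\theta)(\xi)=(v_\pm,u_\pm,\theta_\pm).$$ The monotone solution is the one satisfying, for all $\xi\in\mathbb{R}$, $\tilde v'<0,\ \tilde u'<0,\ \tilde\theta'>0$ in the 1-shock case and $\tilde v'>0,\ \tilde u'<0,\ \tilde\theta'<0$ in the 3-shock case; for $\varepsilon$ small enough (depending on the left-end state) it exists and is unique up to translation in $\xi$, so the normalization $\tilde v_\varepsilon(0)=\frac{v_-+v_+}{2}$ selects exactly one.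
   Formalization: For a 1-shock the stated A is negative and y tends to -1, so the estimate fails as ξ→+∞; the formal statement uses |σ_*| in A and y = |v−v_-|/ε (that is, −(v−v_-)/ε for a 1-shock); the 3-shock case is unchanged. *)

(* Defs.v *)
From Stdlib Require Import Reals.
From Coquelicot Require Import Coquelicot.
Open Scope R_scope.

(* A fluid state (v, u, theta); admissible states have v > 0 and theta > 0. *)
Record state := mkState { vol : R; vel : R; temp : R }.

Definition admissible (w : state) : Prop := 0 < vol w /\ 0 < temp w.

(* The gas constant is written [Rg], since [R] is the type of real numbers. *)
Definition pressure (Rg v theta : R) : R := Rg * theta / v.

Definition energy (Rg gamma u theta : R) : R :=
  Rg / (gamma - 1) * theta + u ^ 2 / 2.

Definition st_pressure (Rg : R) (w : state) : R := pressure Rg (vol w) (temp w).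

Definition st_energy (Rg gamma : R) (w : state) : R :=
  energy Rg gamma (vel w) (temp w).

Definition rankine_hugoniot (Rg gamma : R) (l r : state) (sigma : R) : Prop :=
  - sigma * (vol r - vol l) - (vel r - vel l) = 0 /\
  - sigma * (vel r - vel l) + st_pressure Rg r - st_pressure Rg l = 0 /\
  - sigma * (st_energy Rg gamma r - st_energy Rg gamma l)
    + st_pressure Rg r * vel r - st_pressure Rg l * vel l = 0.

Inductive shock_family := Shock1 | Shock3.

Definition family_sign (s : shock_family) : R :=
  match s with Shock1 => -1 | Shock3 => 1 end.

Definition lax (s : shock_family) (l r : state) : Prop :=
  match s with
  | Shock1 => vol l > vol r /\ vel l > vel r /\ temp l < temp r
  | Shock3 => vol l < vol r /\ vel l > vel r /\ temp l > temp r
  end.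

Definition sigma_eps (Rg : R) (s : shock_family) (l r : state) : R :=
  family_sign s
  * sqrt (- ((st_pressure Rg r - st_pressure Rg l) / (vol r - vol l))).

Definition sigma_star (Rg gamma : R) (s : shock_family) (l : state) : R :=
  family_sign s * sqrt (gamma * st_pressure Rg l / vol l).

(* Transport coefficients are total functions on [R]; only their values on
   (0, +oo) are constrained. [ex_derive_n f 2 x] alone says nothing about
   [ex_derive f], hence the quantification over all orders k <= 2. *)
Definition positive_C2 (f : R -> R) : Prop :=
  forall x, 0 < x ->
    0 < f x /\
    (forall k, (k <= 2)%nat -> ex_derive_n f k x) /\
    continuous (Derive_n f 2) x.

Definition twice_derivable (f : R -> R) : Prop :=
  forall x, ex_derive f x /\ ex_derive (Derive f) x.

(* Classical solutions of the profile problem with speed sigma. Twice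
   differentiability makes every [Derive] below the derivative of a
   differentiable function. *)
Definition profile_solution (Rg gamma : R) (tau mu kappa : R -> R)
    (l r : state) (sigma : R) (v u th : R -> R) : Prop :=
  (forall x, 0 < v x /\ 0 < th x) /\
  (twice_derivable v /\ twice_derivable u /\ twice_derivable th) /\
  (forall x,
    - sigma * Derive v x - Derive u x
    = Derive (fun z => tau (th z) * (Derive v z / v z)) x) /\
  (forall x,
    - sigma * Derive u x + Derive (fun z => pressure Rg (v z) (th z)) x
    = Derive (fun z => mu (th z) * (Derive u z / v z)) x) /\
  (forall x,
    - sigma * Derive (fun z => energy Rg gamma (u z) (th z)) x
    + Derive (fun z => pressure Rg (v z) (th z) * u z) x
    = Derive (fun z => kappa (th z) * (Derive th z / v z)) x
      + Derive (fun z => mu (th z) * (u z * Derive u z / v z)) x) /\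
  (is_lim v m_infty (vol l) /\ is_lim v p_infty (vol r)) /\
  (is_lim u m_infty (vel l) /\ is_lim u p_infty (vel r)) /\
  (is_lim th m_infty (temp l) /\ is_lim th p_infty (temp r)).

Definition monotone_profile (s : shock_family) (v u th : R -> R) : Prop :=
  match s with
  | Shock1 => forall x, Derive v x < 0 /\ Derive u x < 0 /\ Derive th x > 0
  | Shock3 => forall x, Derive v x > 0 /\ Derive u x < 0 /\ Derive th x < 0
  end.

(* The absolute value only matters for a 1-shock, where sigma_* < 0: it makes
   A positive for both families. *)
Definition rate_A (Rg gamma : R) (tau mu kappa : R -> R)
    (s : shock_family) (l : state) : R :=
  Rg * gamma * Rabs (sigma_star Rg gamma s l)
  / (Rg * tau (temp l) + Rg * gamma * mu (temp l)
     + (gamma - 1) ^ 2 * kappa (temp l))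
  * ((gamma + 1) / 2).

(* For a 3-shock this is (v - v_-) / eps. A 1-shock has v < v_-, and the sign is
   reversed so that y increases from 0 to 1 for both families. With
   (v - v_-) / eps, a 1-shock would have y -> -1 and y' / (y (1 - y)) -> 0 at
   +oo, which is incompatible with a rate A eps + O(eps^2), A <> 0. *)
Definition normalized_volume (s : shock_family) (l : state) (eps : R)
    (v : R -> R) (x : R) : R :=
  family_sign s * (v x - vol l) / eps.

(* Main.v *)
(* Integrating the profile equations once gives a first-order system for
   (v, u, theta). At speed sigma_* its linearization at the left state has a
   one-dimensional kernel spanned by (1, -sigma_*, -p_-/c), c = R/(gamma-1),
   and is symmetrizable with its two other eigenvalues of one sign. Hence a
   quadratic Lyapunov function of the derivative (v', u', theta'), vanishing on the
   kernel, would grow monotonically outside the cone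
   "distance to the kernel <= M eps |v'|"; as it tends to 0 at both ends, the orbit
   never leaves the cone, so u'/v' = -sigma_* + O(eps) and
   theta'/v' = -p_-/c + O(eps). Eliminating u and theta from the integrated
   equations then gives N v' = (gamma+1)/2 sigma^2 (v - v_-)(v_+ - v) with
   N = N_* + O(eps), both roots of the quadratic being known because v' = 0 at the
   end states. *)
Require Import Defs.
From Stdlib Require Import Reals Lra.
From Coquelicot Require Import Coquelicot.
Open Scope R_scope.

(** * Asymptotic comparison along a filter *)

(** Two obstacles shape the proof. First, the constants must be uniform in the right state, in the
    profile and in the position. A filter carries this uniformity: along it [bigO] and [approx] are
    closed under arithmetic, so that limit values are found by substitution and few constants are
    tracked by hand. Second, the slopes u'/v' and theta'/v' are needed up to O(eps) at every
    position, although all three derivatives tend to 0 at the ends, where bounds by powers of eps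
    say nothing about ratios. Hence the errors are estimated relative to the derivative vector
    itself, and the cone is a homogeneous condition on that vector. Staying in the cone is a maximum
    principle on the whole line for a profile that is given: no invariant manifold is constructed.
    It only uses that the derivative of the excess over the cone is nonzero where the excess is
    positive, so one computation serves positive and negative speeds. *)

Section BigO.
Context {T : Type} (F : (T -> Prop) -> Prop) {FF : Filter F}.

Definition bigO (f g : T -> R) : Prop :=
  exists C, F (fun i => Rabs (f i) <= C * Rabs (g i)).

Lemma bigO_pos (f g : T -> R) :
  bigO f g -> exists C, 0 < C /\ F (fun i => Rabs (f i) <= C * Rabs (g i)).
Proof.
intros [C HC]; exists (Rabs C + 1); split.
  pose proof (Rabs_pos C); lra.
revert HC; apply filter_imp; intros i Hi.
apply Rle_trans with (1 := Hi).
apply Rmult_le_compat_r; [apply Rabs_pos | pose proof (Rle_abs C); lra].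
Qed.

Lemma bigO_ext_loc (f f' g : T -> R) :
  F (fun i => f i = f' i) -> bigO f g -> bigO f' g.
Proof.
intros E [C HC]; exists C.
generalize (filter_and _ _ E HC); apply filter_imp; intros i [Ei Hi].
now rewrite <- Ei.
Qed.

Lemma bigO_le_loc (f g : T -> R) :
  F (fun i => Rabs (f i) <= Rabs (g i)) -> bigO f g.
Proof.
intros H; exists 1; revert H; apply filter_imp; intros i; lra.
Qed.

Lemma bigO_trans (f g h : T -> R) : bigO f g -> bigO g h -> bigO f h.
Proof.
intros Hf [D HD]; destruct (bigO_pos _ _ Hf) as [C [C0 HC]]; exists (C * D).
generalize (filter_and _ _ HC HD); apply filter_imp; intros i [H1 H2].
rewrite Rmult_assoc; apply Rle_trans with (1 := H1).
now apply Rmult_le_compat_l; [lra |].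
Qed.

Lemma bigO_plus (f1 f2 g : T -> R) :
  bigO f1 g -> bigO f2 g -> bigO (fun i => f1 i + f2 i) g.
Proof.
intros [C HC] [D HD]; exists (C + D).
generalize (filter_and _ _ HC HD); apply filter_imp; intros i [H1 H2].
apply Rle_trans with (1 := Rabs_triang _ _); lra.
Qed.

Lemma bigO_opp (f g : T -> R) : bigO f g -> bigO (fun i => - f i) g.
Proof.
intros [C HC]; exists C; revert HC; apply filter_imp; intros i.
now rewrite Rabs_Ropp.
Qed.

Lemma bigO_minus (f1 f2 g : T -> R) :
  bigO f1 g -> bigO f2 g -> bigO (fun i => f1 i - f2 i) g.
Proof. intros H1 H2; apply bigO_plus; [| apply bigO_opp]; assumption. Qed.

Lemma bigO_mult (f1 f2 g1 g2 : T -> R) :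
  bigO f1 g1 -> bigO f2 g2 ->
  bigO (fun i => f1 i * f2 i) (fun i => g1 i * g2 i).
Proof.
intros [C HC] [D HD]; exists (C * D).
generalize (filter_and _ _ HC HD); apply filter_imp; intros i [H1 H2].
rewrite !Rabs_mult.
replace (C * D * (Rabs (g1 i) * Rabs (g2 i)))
  with (C * Rabs (g1 i) * (D * Rabs (g2 i))) by ring.
apply Rmult_le_compat; auto using Rabs_pos.
Qed.

Definition bounded (f : T -> R) : Prop := bigO f (fun _ => 1).

Lemma bigO_bounded_mult (k f g : T -> R) :
  bounded k -> bigO f g -> bigO (fun i => k i * f i) g.
Proof.
intros Hk Hf; generalize (bigO_mult _ _ _ _ Hk Hf).
intros [C HC]; exists C; revert HC; apply filter_imp; intros i.
now rewrite Rmult_1_l.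
Qed.

Lemma bounded_const (c : R) : bounded (fun _ => c).
Proof.
exists (Rabs c); apply filter_forall; intros i; rewrite Rabs_R1; lra.
Qed.

Context (e : T -> R) (e_small : forall d, 0 < d -> F (fun i => Rabs (e i) < d)).

(** Convergence with a rate: stable under arithmetic like a limit, so that computing a limit value
    yields a first-order error bound at once. *)
Definition approx (f : T -> R) (c : R) : Prop := bigO (fun i => f i - c) e.

Lemma bounded_small (f : T -> R) : bigO f e -> bounded f.
Proof.
intros Hf; apply bigO_trans with (1 := Hf), bigO_le_loc.
generalize (e_small 1 Rlt_0_1); apply filter_imp; intros i.
rewrite Rabs_R1; lra.
Qed.

Lemma approx_bounded (f : T -> R) (c : R) : approx f c -> bounded f.
Proof.
intros Hf; apply bigO_ext_loc with (fun i => (f i - c) + c).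
  apply filter_forall; intros i; ring.
apply bigO_plus; [now apply bounded_small | apply bounded_const].
Qed.

Lemma approx_close (f : T -> R) (c d : R) :
  approx f c -> 0 < d -> F (fun i => Rabs (f i - c) < d).
Proof.
intros Hf Hd; destruct (bigO_pos _ _ Hf) as [C [C0 HC]].
assert (Hq : 0 < d / C) by now apply Rdiv_lt_0_compat.
generalize (filter_and _ _ HC (e_small _ Hq)); apply filter_imp.
intros i [H1 H2]; apply Rle_lt_trans with (1 := H1).
replace d with (C * (d / C)) by (field; lra).
now apply Rmult_lt_compat_l.
Qed.

Lemma approx_gt (f : T -> R) (c d : R) : approx f c -> d < c -> F (fun i => d < f i).
Proof.
intros Hf Hd.
generalize (approx_close _ _ (c - d) Hf (proj2 (Rlt_0_minus _ _) Hd)).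
apply filter_imp; intros i Hi; apply Rabs_def2 in Hi; lra.
Qed.

Lemma approx_ext_loc (f f' : T -> R) (c : R) :
  F (fun i => f i = f' i) -> approx f c -> approx f' c.
Proof.
intros E; apply bigO_ext_loc; revert E; apply filter_imp; intros i ->.
reflexivity.
Qed.

Lemma approx_const (c : R) : approx (fun _ => c) c.
Proof.
exists 0; apply filter_forall; intros i.
rewrite Rminus_diag, Rabs_R0; lra.
Qed.

Lemma approx_small (f : T -> R) : bigO f e -> approx f 0.
Proof.
apply bigO_ext_loc, filter_forall; intros i; ring.
Qed.

Lemma approx_plus (f g : T -> R) (c d : R) :
  approx f c -> approx g d -> approx (fun i => f i + g i) (c + d).
Proof.
intros Hf Hg; apply bigO_ext_loc with (fun i => (f i - c) + (g i - d)).
  apply filter_forall; intros i; ring.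
now apply bigO_plus.
Qed.

Lemma approx_opp (f : T -> R) (c : R) :
  approx f c -> approx (fun i => - f i) (- c).
Proof.
intros Hf; apply bigO_ext_loc with (fun i => - (f i - c)).
  apply filter_forall; intros i; ring.
now apply bigO_opp.
Qed.

Lemma approx_minus (f g : T -> R) (c d : R) :
  approx f c -> approx g d -> approx (fun i => f i - g i) (c - d).
Proof. intros Hf Hg; apply approx_plus; [| apply approx_opp]; assumption. Qed.

Lemma approx_mult (f g : T -> R) (c d : R) :
  approx f c -> approx g d -> approx (fun i => f i * g i) (c * d).
Proof.
intros Hf Hg; apply bigO_ext_loc with (fun i => f i * (g i - d) + d * (f i - c)).
  apply filter_forall; intros i; ring.
apply bigO_plus; apply bigO_bounded_mult; auto using bounded_const.
now apply approx_bounded with c.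
Qed.

(** Derivability at the point [c] gives a Lipschitz bound towards [c]: nearby, the difference
    quotient is within 1 of the derivative [k], whence the factor [Rabs k + 1]. *)
Lemma approx_comp (phi : R -> R) (f : T -> R) (c : R) :
  ex_derive phi c -> approx f c -> approx (fun i => phi (f i)) (phi c).
Proof.
intros [k Hk] Hf.
apply bigO_trans with (2 := Hf).
apply is_derive_Reals in Hk.
destruct (Hk 1 Rlt_0_1) as [d Hd].
exists (Rabs k + 1).
generalize (approx_close _ _ d Hf (cond_pos d)); apply filter_imp; intros i Hi.
destruct (Req_dec (f i - c) 0) as [E | E].
  replace (f i) with c by lra.
  rewrite !Rminus_diag, Rabs_R0; lra.
specialize (Hd _ E Hi).
replace (c + (f i - c)) with (f i) in Hd by ring.
set (q := (phi (f i) - phi c) / (f i - c)) in Hd.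
replace (phi (f i) - phi c) with (q * (f i - c)) by (unfold q; field; exact E).
rewrite Rabs_mult; apply Rmult_le_compat_r; [apply Rabs_pos |].
replace q with (k + (q - k)) by ring.
apply Rle_trans with (1 := Rabs_triang _ _); lra.
Qed.

Lemma approx_inv (f : T -> R) (c : R) :
  c <> 0 -> approx f c -> approx (fun i => / f i) (/ c).
Proof.
intros Hc; apply (approx_comp Rinv); auto_derive; exact Hc.
Qed.

Lemma approx_div (f g : T -> R) (c d : R) :
  d <> 0 -> approx f c -> approx g d -> approx (fun i => f i / g i) (c / d).
Proof. intros Hd Hf Hg; apply approx_mult; [| apply approx_inv]; assumption. Qed.

End BigO.

(** * Limits at infinity and critical points *)

Lemma derive_max_zero (f : R -> R) (x : R) :
  ex_derive f x -> (forall y, f y <= f x) -> Derive f x = 0.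
Proof.
intros Hd Hmax.
assert (pr : derivable_pt f x) by now apply ex_derive_Reals_0.
rewrite <- (Derive_Reals f x pr).
apply deriv_maximum with (x - 1) (x + 1); try lra; auto.
Qed.

(* At a positive value above both limits at infinity, the function would have an
   interior maximum, that is, a critical point with a positive value. *)
Lemma nonpos_of_no_positive_critical (f : R -> R) :
  (forall x, ex_derive f x) ->
  is_lim f m_infty 0 -> is_lim f p_infty 0 ->
  (forall x, 0 < f x -> Derive f x <> 0) ->
  forall x, f x <= 0.
Proof.
intros Hd Hm Hp Hcrit x0; destruct (Rle_lt_dec (f x0) 0) as [H | H]; auto.
exfalso.
apply is_lim_spec in Hm; apply is_lim_spec in Hp.
destruct (Hm (mkposreal _ H)) as [a Ha]; destruct (Hp (mkposreal _ H)) as [b Hb].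
simpl in Ha, Hb.
(* Outside this interval [f] stays below [f x0], so a maximum on the interval is global, even when
   attained at one of its ends. *)
destruct (continuity_ab_maj f (Rmin a x0 - 1) (Rmax b x0 + 1)) as [M [HM _]].
- pose proof (Rmin_r a x0); pose proof (Rmax_r b x0); lra.
- intros c _; apply continuity_pt_filterlim.
  now apply (ex_derive_continuous (V := R_NormedModule)).
- assert (H0 : f x0 <= f M).
    apply HM; pose proof (Rmin_r a x0); pose proof (Rmax_r b x0); lra.
  apply (Hcrit M); [lra |].
  apply derive_max_zero; auto.
  intros y.
  destruct (Rlt_le_dec y (Rmin a x0 - 1)) as [Hy | Hy].
    pose proof (Rmin_l a x0).
    specialize (Ha y ltac:(lra)); apply Rabs_def2 in Ha; lra.
  destruct (Rlt_le_dec (Rmax b x0 + 1) y) as [Hy' | Hy'].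
    pose proof (Rmax_l b x0).
    specialize (Hb y ltac:(lra)); apply Rabs_def2 in Hb; lra.
  now apply HM.
Qed.

Lemma is_lim_opp_arg (f : R -> R) (l : Rbar) :
  is_lim f m_infty l <-> is_lim (fun x => f (- x)) p_infty l.
Proof.
split; intros H.
- apply is_lim_comp with m_infty; auto.
    apply (is_lim_opp (fun x => x) p_infty p_infty), is_lim_id.
  now exists 0; intros.
- apply is_lim_ext with (fun x => (fun z => f (- z)) (- x)).
    intros x; now rewrite Ropp_involutive.
  apply (is_lim_comp (fun z => f (- z)) Ropp m_infty l p_infty); auto.
    apply (is_lim_opp (fun x => x) m_infty m_infty), is_lim_id.
  now exists 0; intros.
Qed.

(** Mean value theorem on [[x, x + 1]] far out: with tolerance |b|/4 the increment of [f] is below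
    |b|/2, while its derivative at the intermediate point exceeds 3|b|/4 in absolute value. *)
Lemma lim_derive_p_infty (f : R -> R) (a b : R) :
  (forall x, ex_derive f x) ->
  is_lim f p_infty a -> is_lim (Derive f) p_infty b -> b = 0.
Proof.
intros Hd Hf Hb.
destruct (Req_dec b 0) as [E | E]; auto; exfalso.
assert (P : 0 < Rabs b / 4) by (pose proof (Rabs_pos_lt b E); lra).
apply is_lim_spec in Hf; apply is_lim_spec in Hb.
destruct (Hf (mkposreal _ P)) as [M1 H1]; destruct (Hb (mkposreal _ P)) as [M2 H2].
simpl in H1, H2.
set (x := Rmax M1 M2 + 1).
assert (Hx : M1 < x /\ M2 < x).
  unfold x; pose proof (Rmax_l M1 M2); pose proof (Rmax_r M1 M2); lra.
destruct (MVT_gen f x (x + 1) (Derive f)) as [c [Hc Ec]].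
- intros; now apply Derive_correct.
- intros; apply continuity_pt_filterlim.
  now apply (ex_derive_continuous (V := R_NormedModule)).
- rewrite Rmin_left in Hc by lra; rewrite Rmax_right in Hc by lra.
  pose proof (H1 x ltac:(lra)) as A1; pose proof (H1 (x + 1) ltac:(lra)) as A2.
  pose proof (H2 c ltac:(lra)) as A3.
  apply Rabs_def2 in A1; apply Rabs_def2 in A2; apply Rabs_def2 in A3.
  replace (x + 1 - x) with 1 in Ec by ring.
  revert P A1 A2 A3; unfold Rabs; destruct (Rcase_abs b); lra.
Qed.

Lemma lim_derive_m_infty (f : R -> R) (a b : R) :
  (forall x, ex_derive f x) ->
  is_lim f m_infty a -> is_lim (Derive f) m_infty b -> b = 0.
Proof.
intros Hd Hf Hb.
assert (E : forall x, Derive (fun z => f (- z)) x = - Derive f (- x)).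
  intros x; rewrite (Derive_comp f Ropp); auto.
    rewrite (Derive_ext Ropp (fun z => - z)) by reflexivity.
    rewrite Derive_opp, Derive_id; ring.
  auto_derive; auto.
enough (- b = 0) by lra.
apply (lim_derive_p_infty (fun z => f (- z)) a).
- intros x; apply (ex_derive_comp f Ropp); auto; auto_derive; auto.
- now apply (proj1 (is_lim_opp_arg f a)).
- apply is_lim_ext with (fun x => - Derive f (- x)).
    intros x; now rewrite E.
  apply (is_lim_opp (fun x => Derive f (- x)) p_infty b).
  now apply (proj1 (is_lim_opp_arg (Derive f) b)).
Qed.

Definition is_infinite (z : Rbar) : Prop := z = m_infty \/ z = p_infty.

Lemma lim_derive_zero (f : R -> R) (z : Rbar) (a b : R) :
  is_infinite z -> (forall x, ex_derive f x) ->
  is_lim f z a -> is_lim (Derive f) z b -> b = 0.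
Proof.
intros [-> | ->]; eauto using lim_derive_m_infty, lim_derive_p_infty.
Qed.

Lemma is_lim_continuous_comp (phi f : R -> R) (z : Rbar) (a : R) :
  continuous phi a -> is_lim f z a -> is_lim (fun x => phi (f x)) z (phi a).
Proof.
intros Hc Hf; apply (filterlim_comp _ _ _ f phi _ (locally a)); auto.
Qed.

(* [k * f' / w = g] is the shape of the once-integrated profile equations. *)
Lemma lim_flux_zero (f k w g : R -> R) (z : Rbar) (a k0 w0 g0 : R) :
  is_infinite z -> (forall x, ex_derive f x) ->
  (forall x, 0 < k x /\ 0 < w x) -> 0 < k0 -> 0 < w0 ->
  (forall x, k x * (Derive f x / w x) = g x) ->
  is_lim f z a -> is_lim k z k0 -> is_lim w z w0 -> is_lim g z g0 ->
  g0 = 0 /\ is_lim (Derive f) z 0.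
Proof.
intros Hz Hd Hpos Hk0 Hw0 Heq Hf Hk Hw Hg.
(* No limit of [Derive f] is assumed: the equation supplies one, and convergence of [f] forces it to
   be 0. *)
assert (L : is_lim (Derive f) z (g0 * w0 * / k0)).
  apply is_lim_ext with (fun x => g x * w x * / k x).
    intros x; rewrite <- Heq; field; specialize (Hpos x); lra.
  apply (is_lim_mult _ _ z (g0 * w0) (/ k0)); [| | exact I].
    apply (is_lim_mult g w z g0 w0); [assumption.. | exact I].
  apply (is_lim_inv k z k0); auto.
  intros E; injection E; lra.
assert (Z : g0 * w0 * / k0 = 0) by (apply (lim_derive_zero f z a); auto).
split.
- replace g0 with (g0 * w0 * / k0 * (k0 / w0)) by (field; lra).
  rewrite Z; ring.
- now rewrite Z in L.
Qed.

Lemma derive_eq_const (f g : R -> R) :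
  (forall x, ex_derive f x) -> (forall x, ex_derive g x) ->
  (forall x, Derive f x = Derive g x) ->
  exists c, forall x, g x = f x + c.
Proof.
intros Hf Hg E; exists (g 0 - f 0); intros x.
destruct (MVT_gen (fun z => g z - f z) 0 x (fun _ => 0)) as [c [_ Hc]].
- intros z _.
  replace 0 with (Derive g z - Derive f z) by (rewrite E; ring).
  apply (is_derive_minus (K := R_AbsRing) (V := R_NormedModule) g f z
           (Derive g z) (Derive f z)); now apply Derive_correct.
- intros z _; apply continuity_pt_filterlim.
  apply (ex_derive_continuous (V := R_NormedModule) (fun t => g t - f t)).
  apply (ex_derive_minus (V := R_NormedModule) g f z); auto.
- simpl in Hc; lra.
Qed.

Lemma increasing_between_limits (f : R -> R) (a b x : R) :
  (forall z, ex_derive f z) -> (forall z, 0 < Derive f z) ->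
  is_lim f m_infty a -> is_lim f p_infty b -> a < f x < b.
Proof.
intros Hd Hpos Ha Hb.
assert (Inc : forall y z, y < z -> f y < f z).
  intros y z Hyz; apply (incr_function f m_infty p_infty (Derive f)); simpl; auto.
    intros t _ _; now apply Derive_correct.
  intros t _ _; apply Hpos.
assert (A : forall y, a <= f y).
  intros y; apply (is_lim_le_loc f (fun _ => f y) m_infty a (f y));
    auto using is_lim_const.
  exists y; intros z Hz; left; auto.
assert (B : forall y, f y <= b).
  intros y; apply (is_lim_le_loc (fun _ => f y) f p_infty (f y) b);
    auto using is_lim_const.
  exists y; intros z Hz; left; auto.
split.
- apply Rle_lt_trans with (f (x - 1)); auto; apply Inc; lra.
- apply Rlt_le_trans with (f (x + 1)); auto; apply Inc; lra.
Qed.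

Lemma decreasing_between_limits (f : R -> R) (a b x : R) :
  (forall z, ex_derive f z) -> (forall z, Derive f z < 0) ->
  is_lim f m_infty a -> is_lim f p_infty b -> b < f x < a.
Proof.
intros Hd Hneg Ha Hb.
enough (- a < - f x < - b) by lra.
apply (increasing_between_limits (fun z => - f z)).
- intros z; apply (ex_derive_opp (V := R_NormedModule) f z); auto.
- intros z; rewrite Derive_opp; specialize (Hneg z); lra.
- apply (is_lim_opp f m_infty a Ha).
- apply (is_lim_opp f p_infty b Hb).
Qed.

(** * The integrated profile equations *)

Lemma is_lim_mult_finite (f g : R -> R) (z : Rbar) (a b : R) :
  is_lim f z a -> is_lim g z b -> is_lim (fun x => f x * g x) z (a * b).
Proof. intros Hf Hg; apply (is_lim_mult f g z a b); auto; exact I. Qed.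

Lemma is_lim_opp_finite (f : R -> R) (z : Rbar) (a : R) :
  is_lim f z a -> is_lim (fun x => - f x) z (- a).
Proof. intros Hf; apply (is_lim_opp f z a); auto. Qed.

Lemma is_lim_div_finite (f g : R -> R) (z : Rbar) (a b : R) :
  b <> 0 -> is_lim f z a -> is_lim g z b -> is_lim (fun x => f x / g x) z (a / b).
Proof.
intros Hb Hf Hg; apply (is_lim_mult_finite f (fun x => / g x)); auto.
apply (is_lim_inv g z b); auto.
intros E; injection E; auto.
Qed.

Lemma is_lim_const_finite (z : Rbar) (a : R) : is_lim (fun _ => a) z a.
Proof. apply is_lim_const. Qed.

Lemma is_lim_value (f : R -> R) (z : Rbar) (a b : R) :
  is_lim f z a -> a = b -> is_lim f z b.
Proof. now intros H <-. Qed.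

(** Builds the limit value by the shape of the function. Powers have no case, so squares of
    functions are first rewritten as products. *)
Ltac solve_lim :=
  match goal with
  | H : is_lim ?f ?z _ |- is_lim ?f ?z _ => exact H
  | |- is_lim (fun x => _ + _) _ _ => eapply is_lim_plus'; solve_lim
  | |- is_lim (fun x => _ - _) _ _ => eapply is_lim_minus'; solve_lim
  | |- is_lim (fun x => - _) _ _ => eapply is_lim_opp_finite; solve_lim
  | |- is_lim (fun x => _ * _) _ _ => eapply is_lim_mult_finite; solve_lim
  | |- is_lim (fun x => _ / _) _ _ => eapply is_lim_div_finite; [| solve_lim ..]
  | |- _ => first [ eassumption | apply is_lim_const_finite ]
  end.

Lemma positive_C2_derivable (f : R -> R) (x : R) :
  positive_C2 f -> 0 < x -> ex_derive f x.
Proof.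
intros Hf Hx; destruct (Hf x Hx) as [_ [H _]]; apply (H 1%nat); auto.
Qed.

Lemma positive_C2_derivable2 (f : R -> R) (x : R) :
  positive_C2 f -> 0 < x -> ex_derive (Derive f) x.
Proof.
intros Hf Hx; destruct (Hf x Hx) as [_ [H _]]; apply (H 2%nat); auto.
Qed.

Lemma positive_C2_pos (f : R -> R) (x : R) : positive_C2 f -> 0 < x -> 0 < f x.
Proof. intros Hf Hx; apply (Hf x Hx). Qed.

Section Profile.
Context (Rg gamma : R) (tau mu kappa : R -> R).
Context (gamma_gt1 : 1 < gamma).
Context (tauC2 : positive_C2 tau) (muC2 : positive_C2 mu) (kappaC2 : positive_C2 kappa).
Context (l : state) (l_adm : admissible l).

Let p0 := st_pressure Rg l.
Let cv := Rg / (gamma - 1).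

Context (r : state) (r_adm : admissible r) (sigma : R) (v u th : R -> R).
Context (prof : profile_solution Rg gamma tau mu kappa l r sigma v u th).

Let P x := pressure Rg (v x) (th x).

Lemma profile_pos (x : R) : 0 < v x /\ 0 < th x.
Proof. apply prof. Qed.

Lemma profile_derivable (x : R) :
  (ex_derive v x /\ ex_derive u x /\ ex_derive th x) /\
  (ex_derive (Derive v) x /\ ex_derive (Derive u) x /\ ex_derive (Derive th) x).
Proof.
destruct prof as [_ [[Hv [Hu Ht]] _]].
destruct (Hv x), (Hu x), (Ht x); tauto.
Qed.

Definition end_value (z : Rbar) (w : state) : Prop :=
  z = m_infty /\ w = l \/ z = p_infty /\ w = r.

Lemma end_value_infinite (z : Rbar) (w : state) : end_value z w -> is_infinite z.
Proof. unfold is_infinite; intros [[-> _] | [-> _]]; auto. Qed.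

Lemma end_value_admissible (z : Rbar) (w : state) : end_value z w -> admissible w.
Proof. now intros [[_ ->] | [_ ->]]. Qed.

Lemma end_value_limits (z : Rbar) (w : state) :
  end_value z w ->
  is_lim v z (vol w) /\ is_lim u z (vel w) /\ is_lim th z (temp w).
Proof.
destruct prof as (_ & _ & _ & _ & _ & Hv & Hu & Ht).
intros [[-> ->] | [-> ->]]; tauto.
Qed.

Lemma lim_transport (k : R -> R) (z : Rbar) (w : state) :
  positive_C2 k -> end_value z w -> is_lim (fun x => k (th x)) z (k (temp w)).
Proof.
intros Hk Hz; apply is_lim_continuous_comp.
  apply (ex_derive_continuous (V := R_NormedModule)).
  apply positive_C2_derivable; auto.
  now apply (end_value_admissible z w).
now apply (end_value_limits z w).
Qed.

Lemma lim_pressure (z : Rbar) (w : state) :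
  end_value z w -> is_lim P z (st_pressure Rg w).
Proof.
intros Hz; destruct (end_value_limits z w Hz) as (Lv & Lu & Lt).
destruct (end_value_admissible z w Hz) as [Hv _].
unfold P, st_pressure, pressure; solve_lim; lra.
Qed.

(** At the left end this fixes the constants of integration; at both ends it makes the derivatives
    vanish in the limit. *)
Lemma flux_end (k : R -> R) (f g : R -> R) (a g0 : R) (z : Rbar) (w : state) :
  positive_C2 k -> end_value z w -> (forall x, ex_derive f x) ->
  (forall x, k (th x) * (Derive f x / v x) = g x) ->
  is_lim f z a -> is_lim g z g0 ->
  g0 = 0 /\ is_lim (Derive f) z 0.
Proof.
intros Hk Hz Hd E Lf Lg.
destruct (end_value_admissible z w Hz) as [Hv Ht].
apply (lim_flux_zero f (fun x => k (th x)) v g z a (k (temp w)) (vol w)); auto.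
- now apply end_value_infinite with w.
- intros x; destruct (profile_pos x); split; auto; now apply positive_C2_pos.
- now apply positive_C2_pos.
- now apply lim_transport.
- now apply (end_value_limits z w).
Qed.

Lemma flux_derivable (k f : R -> R) (x : R) :
  positive_C2 k -> ex_derive (Derive f) x ->
  ex_derive (fun z => k (th z) * (Derive f z / v z)) x.
Proof.
intros Hk Hf.
destruct (profile_derivable x) as [[Hv [Hu Ht]] _]; destruct (profile_pos x).
auto_derive; repeat split; auto; try lra.
now apply positive_C2_derivable.
Qed.

Lemma pressure_derivable (x : R) : ex_derive P x.
Proof.
destruct (profile_derivable x) as [[Hv [Hu Ht]] _]; destruct (profile_pos x).
unfold P, pressure; auto_derive; repeat split; auto; lra.
Qed.

Definition volume_flux x := - sigma * (v x - vol l) - (u x - vel l).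
Definition momentum_flux x := - sigma * (u x - vel l) + P x - p0.
(** Integrated energy equation minus [u] times the integrated momentum equation. The products
    [P * u] cancel, which leaves only the constant pressure [p0] and the square of the velocity
    difference. *)
Definition thermal_flux x :=
  - sigma * (cv * (th x - temp l) - (u x - vel l) ^ 2 / 2) + p0 * (u x - vel l).

Lemma volume_integrated (x : R) : tau (th x) * (Derive v x / v x) = volume_flux x.
Proof.
destruct (derive_eq_const (fun z => - sigma * v z - u z)
            (fun z => tau (th z) * (Derive v z / v z))) as [c Hc].
- intros z; destruct (profile_derivable z) as [[Hv [Hu Ht]] _].
  auto_derive; auto.
- intros z; apply flux_derivable; auto; apply profile_derivable.
- intros z; destruct (profile_derivable z) as [[Hv [Hu Ht]] _].
  destruct prof as (_ & _ & H1 & _); rewrite <- H1.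
  rewrite Derive_minus, Derive_scal; auto.
  apply ex_derive_scal; auto.
- assert (Hz : end_value m_infty l) by (left; auto).
  destruct (end_value_limits _ _ Hz) as (Lv & Lu & Lt).
  destruct (flux_end tau v (fun x => - sigma * v x - u x + c) (vol l)
    (- sigma * vol l - vel l + c) m_infty l) as [E _]; auto.
    intros t; apply profile_derivable.
    solve_lim.
  rewrite Hc; unfold volume_flux; lra.
Qed.

Lemma momentum_integrated (x : R) : mu (th x) * (Derive u x / v x) = momentum_flux x.
Proof.
destruct (derive_eq_const (fun z => - sigma * u z + P z)
            (fun z => mu (th z) * (Derive u z / v z))) as [c Hc].
- intros z; destruct (profile_derivable z) as [[Hv [Hu Ht]] _].
  pose proof (pressure_derivable z); auto_derive; auto.
- intros z; apply flux_derivable; auto; apply profile_derivable.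
- intros z; destruct (profile_derivable z) as [[Hv [Hu Ht]] _].
  destruct prof as (_ & _ & _ & H2 & _); rewrite <- H2.
  rewrite Derive_plus, Derive_scal; auto.
  apply ex_derive_scal; auto.
  apply pressure_derivable.
- assert (Hz : end_value m_infty l) by (left; auto).
  destruct (end_value_limits _ _ Hz) as (Lv & Lu & Lt).
  pose proof (lim_pressure _ _ Hz).
  destruct (flux_end mu u (fun x => - sigma * u x + P x + c) (vel l)
    (- sigma * vel l + p0 + c) m_infty l) as [E _]; auto.
    intros t; apply profile_derivable.
    unfold p0; solve_lim.
  rewrite Hc; unfold momentum_flux; lra.
Qed.

Lemma thermal_integrated (x : R) : kappa (th x) * (Derive th x / v x) = thermal_flux x.
Proof.
set (E z := energy Rg gamma (u z) (th z)).
assert (DE : forall z, ex_derive E z).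
  intros z; destruct (profile_derivable z) as [[Hv [Hu Ht]] _].
  unfold E, energy; auto_derive; auto.
assert (DM : forall z, ex_derive (fun z => mu (th z) * (u z * Derive u z / v z)) z).
  intros z; destruct (profile_derivable z) as [[Hv [Hu Ht]] [_ [Hu' _]]].
  destruct (profile_pos z).
  auto_derive; repeat split; auto; try lra.
  now apply positive_C2_derivable.
assert (DK : forall z, ex_derive (fun z => kappa (th z) * (Derive th z / v z)) z).
  intros z; apply flux_derivable; auto; apply profile_derivable.
destruct (derive_eq_const (fun z => - sigma * E z + P z * u z)
            (fun z => kappa (th z) * (Derive th z / v z)
               + mu (th z) * (u z * Derive u z / v z))) as [c Hc].
- intros z; destruct (profile_derivable z) as [[Hv [Hu Ht]] _].
  pose proof (pressure_derivable z); auto_derive; auto.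
- intros z; apply (ex_derive_plus (V := R_NormedModule)
    (fun z => kappa (th z) * (Derive th z / v z))); auto.
- intros z; destruct (profile_derivable z) as [[Hv [Hu Ht]] _].
  pose proof (pressure_derivable z).
  destruct prof as (_ & _ & _ & _ & H3 & _).
  rewrite (Derive_plus (fun z => kappa (th z) * (Derive th z / v z))); auto.
  rewrite <- H3.
  rewrite Derive_plus, Derive_scal; auto.
  apply ex_derive_scal; auto.
  apply (ex_derive_mult P u); auto.
- set (g x := - sigma * E x + P x * u x + c - u x * momentum_flux x).
  assert (Hg : forall z, kappa (th z) * (Derive th z / v z) = g z).
    intros z; specialize (Hc z); unfold g; rewrite <- momentum_integrated.
    destruct (profile_pos z).
    replace (mu (th z) * (u z * Derive u z / v z))
      with (u z * (mu (th z) * (Derive u z / v z))) in Hc by (field; lra).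
    lra.
  assert (Hz : end_value m_infty l) by (left; auto).
  destruct (end_value_limits _ _ Hz) as (Lv & Lu & Lt).
  pose proof (lim_pressure _ _ Hz) as LP.
  destruct (flux_end kappa th g (temp l)
    (- sigma * st_energy Rg gamma l + p0 * vel l + c) m_infty l) as [F _]; auto.
    intros t; apply profile_derivable.
    unfold g, momentum_flux, E, energy, p0.
    apply is_lim_ext with (fun x => - sigma * (cv * th x + u x * u x / 2) + P x * u x + c
       - u x * (- sigma * (u x - vel l) + P x - st_pressure Rg l)).
      intros y; fold cv; field.
    eapply is_lim_value; [solve_lim; lra |].
    unfold st_energy, energy; fold cv; field.
  rewrite Hg; unfold g, thermal_flux, momentum_flux, E, energy.
  unfold st_energy, energy in F; fold cv in F |- *; lra.
Qed.

(** At the right end the three identities are the jump conditions for this [sigma], the energy one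
    reduced to internal energy. They are read off the profile. *)
Lemma profile_end (z : Rbar) (w : state) :
  end_value z w ->
  - sigma * (vol w - vol l) - (vel w - vel l) = 0 /\
  - sigma * (vel w - vel l) + st_pressure Rg w - p0 = 0 /\
  - sigma * (cv * (temp w - temp l) - (vel w - vel l) ^ 2 / 2)
    + p0 * (vel w - vel l) = 0 /\
  is_lim (Derive v) z 0 /\ is_lim (Derive u) z 0 /\ is_lim (Derive th) z 0.
Proof.
intros Hz; destruct (end_value_limits _ _ Hz) as (Lv & Lu & Lt).
pose proof (lim_pressure _ _ Hz) as LP.
destruct (flux_end tau v volume_flux (vol w)
  (- sigma * (vol w - vol l) - (vel w - vel l)) z w) as [E1 L1]; auto.
  intros x; apply profile_derivable.
  apply volume_integrated.
  unfold volume_flux; solve_lim.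
destruct (flux_end mu u momentum_flux (vel w)
  (- sigma * (vel w - vel l) + st_pressure Rg w - p0) z w) as [E2 L2]; auto.
  intros x; apply profile_derivable.
  apply momentum_integrated.
  unfold momentum_flux; solve_lim.
destruct (flux_end kappa th thermal_flux (temp w)
  (- sigma * (cv * (temp w - temp l) - (vel w - vel l) ^ 2 / 2)
    + p0 * (vel w - vel l)) z w) as [E3 L3]; auto.
  intros x; apply profile_derivable.
  apply thermal_integrated.
  unfold thermal_flux.
  apply is_lim_ext with (fun x => - sigma * (cv * (th x - temp l)
     - (u x - vel l) * (u x - vel l) / 2) + p0 * (u x - vel l)).
    intros y; field.
  eapply is_lim_value; [solve_lim; lra | field].
tauto.
Qed.

(** * Second-order equations and the Lyapunov identity *)

Let U x := u x - vel l.
Let G := Derive v.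
Let H := Derive u.
Let K := Derive th.

(** Product rule for [f' = (v / k) * g]. The bracket is the logarithmic derivative of [v / k (th)];
    it will be small with the shock, so the first term is the principal one. *)
Lemma flux_derivative (k f g : R -> R) (x dg : R) :
  positive_C2 k -> ex_derive (Derive f) x ->
  (forall z, k (th z) * (Derive f z / v z) = g z) -> is_derive g x dg ->
  Derive (Derive f) x
  = v x / k (th x) * dg + (G x / v x - Derive k (th x) * K x / k (th x)) * Derive f x.
Proof.
intros Hk Hf Eg Hg.
destruct (profile_derivable x) as [[Hv [Hu Ht]] _]; destruct (profile_pos x) as [pv pt].
pose proof (positive_C2_pos _ _ Hk pt) as pk.
assert (D : is_derive g x (Derive k (th x) * K x * (Derive f x / v x)
   + k (th x) * ((Derive (Derive f) x * v x - Derive f x * G x) / v x ^ 2))).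
  apply is_derive_ext with (1 := Eg).
  unfold G, K.
  auto_derive; repeat split; auto; try lra.
  - now apply positive_C2_derivable.
  - rewrite (Derive_ext (fun x => th x) th), (Derive_ext (fun x => v x) v) by reflexivity.
    rewrite (Derive_ext (fun x => Derive f x) (Derive f)) by reflexivity.
    rewrite (Derive_ext (fun x => k x) k) by reflexivity.
    field; lra.
apply is_derive_unique in D; apply is_derive_unique in Hg; rewrite Hg in D.
rewrite D; field; lra.
Qed.

(** For [sigma <> 0] both defects vanish exactly on the line of (1, -sigma, -p0/cv), so they are
    coordinates transverse to the kernel, taken at the actual speed. A momentum defect would be
    redundant: to leading order it is a combination of these two. *)
Definition defect1 x := - sigma * Derive v x - Derive u x.
Definition defect3 x := - sigma * cv * Derive th x + p0 * Derive u x.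

Lemma derive_G (x : R) :
  Derive G x = v x / tau (th x) * defect1 x
    + (G x / v x - Derive tau (th x) * K x / tau (th x)) * G x.
Proof.
destruct (profile_derivable x) as [[Hv [Hu Ht]] [Hv' _]].
apply flux_derivative with volume_flux; auto using volume_integrated.
unfold volume_flux, defect1; auto_derive; auto.
rewrite (Derive_ext (fun x => v x) v), (Derive_ext (fun x => u x) u) by reflexivity.
ring.
Qed.

Lemma derive_H (x : R) :
  Derive H x = v x / mu (th x) * (- sigma * H x + Rg * K x / v x - P x * G x / v x)
    + (G x / v x - Derive mu (th x) * K x / mu (th x)) * H x.
Proof.
destruct (profile_derivable x) as [[Hv [Hu Ht]] [_ [Hu' _]]].
destruct (profile_pos x) as [pv pt].
apply flux_derivative with momentum_flux; auto using momentum_integrated.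
unfold momentum_flux, P, pressure; auto_derive; repeat split; auto; try lra.
rewrite (Derive_ext (fun x => v x) v), (Derive_ext (fun x => u x) u),
  (Derive_ext (fun x => th x) th) by reflexivity.
unfold G, H, K; field; lra.
Qed.

Lemma derive_K (x : R) :
  Derive K x = v x / kappa (th x) * (defect3 x + sigma * U x * H x)
    + (G x / v x - Derive kappa (th x) * K x / kappa (th x)) * K x.
Proof.
destruct (profile_derivable x) as [[Hv [Hu Ht]] [_ [_ Ht']]].
apply flux_derivative with thermal_flux; auto using thermal_integrated.
unfold thermal_flux, defect3; auto_derive; auto.
rewrite (Derive_ext (fun x => u x) u), (Derive_ext (fun x => th x) th) by reflexivity.
unfold U, H; field.
Qed.

(* These weights symmetrize the linearized system at sigma_*: the coupling of the
   two defects then enters [dissipation] as a perfect square. *)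
Definition lyapunov x := p0 ^ 2 * defect1 x ^ 2 + (gamma - 1) * defect3 x ^ 2.

Definition dissipation x :=
  sigma ^ 2 * (p0 ^ 2 * (v x / tau (th x)) * defect1 x ^ 2
               + (gamma - 1) * cv * (v x / kappa (th x)) * defect3 x ^ 2)
  + p0 / mu (th x) * (p0 * defect1 x - (gamma - 1) * defect3 x) ^ 2.

Definition relative_variation (k : R -> R) x :=
  G x / v x - Derive k (th x) * K x / k (th x).

(** The remainder of [sigma * Derive H] after its principal part, the combination of defects squared
    in [dissipation]. The coefficient of [H] in its first term vanishes at the left state when
    [sigma ^ 2 = gamma * p0 / vol l], that is, at the limiting speed. *)
Definition velocity_error x :=
  v x / mu (th x) * (- sigma ^ 2 + (gamma - 1) * p0 / v x + P x / v x) * H x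
  + / mu (th x) * (P x - p0) * defect1 x + sigma * (relative_variation mu x * H x).

Definition lyapunov_error x :=
  p0 ^ 2 * defect1 x
    * (- sigma ^ 2 * (relative_variation tau x * G x) - velocity_error x)
  + (gamma - 1) * defect3 x
    * (- (sigma ^ 2 * cv * (v x / kappa (th x) * sigma * (U x * H x)
                            + relative_variation kappa x * K x))
       + p0 * velocity_error x).

(** In half of [sigma * d], [H'] enters as [- p0 * (sigma * H') * (p0 * defect1 - (gamma - 1) *
    defect3)], and [sigma * H'] is the last factor over [mu] up to an error: hence the square. The
    factor [sigma] makes the damping coefficients even in the speed, so the identity is the same for
    both families. *)
Lemma lyapunov_is_derive (x : R) :
  exists d, is_derive lyapunov x d /\
    sigma * d = - (2 * dissipation x) + 2 * lyapunov_error x.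
Proof.
destruct (profile_derivable x) as [_ [Hv' [Hu' Ht']]].
destruct (profile_pos x) as [pv pt].
pose proof (positive_C2_pos _ _ tauC2 pt).
pose proof (positive_C2_pos _ _ muC2 pt).
pose proof (positive_C2_pos _ _ kappaC2 pt).
exists (p0 ^ 2 * (2 * defect1 x * (- sigma * Derive G x - Derive H x))
   + (gamma - 1) * (2 * defect3 x * (- sigma * cv * Derive K x + p0 * Derive H x))).
split.
- unfold lyapunov, defect1, defect3, G, H, K; auto_derive; repeat split; auto.
  rewrite (Derive_ext (fun x => Derive v x) (Derive v)),
   (Derive_ext (fun x => Derive u x) (Derive u)),
   (Derive_ext (fun x => Derive th x) (Derive th)) by reflexivity.
  ring.
- assert (EH : sigma * Derive H x
     = / mu (th x) * (p0 * defect1 x - (gamma - 1) * defect3 x) + velocity_error x).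
    rewrite derive_H; unfold velocity_error, relative_variation, defect1, defect3.
    fold G H K; unfold cv; field; lra.
  transitivity (2 * p0 ^ 2 * defect1 x * (- sigma ^ 2 * Derive G x - sigma * Derive H x)
    + 2 * (gamma - 1) * defect3 x
      * (- sigma ^ 2 * cv * Derive K x + p0 * (sigma * Derive H x))).
    ring.
  rewrite EH, derive_G, derive_K.
  unfold dissipation, lyapunov_error, relative_variation; field; lra.
Qed.

Lemma lyapunov_end (z : Rbar) (w : state) : end_value z w -> is_lim lyapunov z 0.
Proof.
intros Hz; destruct (profile_end z w Hz) as (_ & _ & _ & LG & LH & LK).
apply is_lim_ext with (fun x => p0 ^ 2
    * ((- sigma * Derive v x - Derive u x) * (- sigma * Derive v x - Derive u x))
  + (gamma - 1) * ((- sigma * cv * Derive th x + p0 * Derive u x)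
    * (- sigma * cv * Derive th x + p0 * Derive u x))).
  intros x; unfold lyapunov, defect1, defect3; ring.
eapply is_lim_value; [solve_lim | ring].
Qed.

(** * The jump relation and the quadratic equation for the volume *)

Lemma speed_relation :
  sigma <> 0 -> vol r <> vol l ->
  sigma ^ 2 * (vol l + (gamma + 1) / 2 * (vol r - vol l)) = gamma * p0.
Proof.
intros Hs Hr.
destruct (profile_end p_infty r) as (E1 & E2 & E3 & _); [right; auto |].
destruct l_adm as [pl _]; destruct r_adm as [pr _].
set (V := vol r - vol l) in *.
assert (EU : vel r - vel l = - sigma * V) by lra.
rewrite EU in E2, E3.
assert (ET : cv * (temp r - temp l) = sigma ^ 2 * V ^ 2 / 2 - p0 * V).
  apply Rmult_eq_reg_l with sigma; auto; lra.
assert (EP : Rg * (temp r - temp l) = vol r * st_pressure Rg r - vol l * p0).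
  unfold p0, st_pressure, pressure; field; lra.
assert (ERg : Rg * (temp r - temp l) = (gamma - 1) * (cv * (temp r - temp l))).
  unfold cv; field; lra.
rewrite EP, ET in ERg.
replace (st_pressure Rg r) with (p0 - sigma ^ 2 * V) in ERg by lra.
replace (vol r) with (vol l + V) in ERg by (unfold V; ring).
(* Eliminating velocity and temperature leaves the volume jump as a common factor; cancelling it
   gives the squared speed in closed form. *)
apply Rmult_eq_reg_l with V; [lra | unfold V; lra].
Qed.

(* Substituting the integrated equations into the equation of state leaves a
   quadratic in [v - vol l], proportional to [Derive v]; it also vanishes at the
   right state, so both of its roots are known. *)
Lemma volume_rate (x h k : R) :
  sigma <> 0 -> vol r <> vol l ->
  H x = h * G x -> K x = k * G x ->
  ((gamma - 1) * (sigma * tau (th x) * (v x - vol l) / v x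
       + tau (th x) ^ 2 * G x / (2 * v x ^ 2))
   - (gamma - 1) * p0 * tau (th x) / (sigma * v x)
   - (gamma - 1) * kappa (th x) * k / (sigma * v x)
   + sigma * tau (th x) - mu (th x) * h) * G x
  = (gamma + 1) / 2 * sigma ^ 2 * (v x - vol l) * (vol r - v x).
Proof.
intros Hs Hr EH EK.
pose proof (speed_relation Hs Hr) as S.
destruct l_adm as [pl _]; destruct (profile_pos x) as [pv pt].
pose proof (volume_integrated x) as E1; fold G in E1.
pose proof (momentum_integrated x) as E2; fold H in E2; rewrite EH in E2.
pose proof (thermal_integrated x) as E3; fold K in E3; rewrite EK in E3.
unfold volume_flux, momentum_flux, thermal_flux in *.
assert (ERg : v x * P x - vol l * p0 = (gamma - 1) * (cv * (th x - temp l))).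
  unfold P, p0, cv, st_pressure, pressure; field; lra.
assert (EU : u x - vel l = - sigma * (v x - vol l) - tau (th x) * (G x / v x)) by lra.
assert (EP : P x = p0 + sigma * (u x - vel l) + mu (th x) * (h * G x / v x)) by lra.
assert (ET : cv * (th x - temp l) = (u x - vel l) ^ 2 / 2
    + (p0 * (u x - vel l) - kappa (th x) * (k * G x / v x)) / sigma).
  apply Rmult_eq_reg_l with sigma; auto.
  replace (sigma * ((u x - vel l) ^ 2 / 2
    + (p0 * (u x - vel l) - kappa (th x) * (k * G x / v x)) / sigma))
   with (sigma * ((u x - vel l) ^ 2 / 2)
    + (p0 * (u x - vel l) - kappa (th x) * (k * G x / v x))) by (field; split; auto; lra).
  lra.
rewrite EP, ET, EU in ERg.
assert (S' : (gamma + 1) / 2 * sigma ^ 2 * (vol r - vol l)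
  = gamma * p0 - sigma ^ 2 * vol l) by lra.
replace ((gamma + 1) / 2 * sigma ^ 2 * (v x - vol l) * (vol r - v x))
  with ((v x - vol l) * ((gamma + 1) / 2 * sigma ^ 2 * (vol r - vol l)
     - (gamma + 1) / 2 * sigma ^ 2 * (v x - vol l))) by ring.
rewrite S'.
apply Rminus_diag_uniq; apply Rminus_diag_eq in ERg.
rewrite <- Ropp_0, <- ERg; field; split; auto; lra.
Qed.

End Profile.

(** * The invariant cone *)

(* Numerical core of the cone argument: outside a cone [Phi <= (M e G)^2] of
   large aperture [M], the dissipation [c0 n^2] dominates every error term. *)
Lemma cone_exit (c0 C0 C1 C2 : R) :
  0 < c0 -> 0 < C0 -> 0 < C1 -> 0 < C2 ->
  exists M d, 0 < M /\ 0 < d /\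
  forall e n G Phi sigma dPhi dG,
  0 <= e < d -> 0 <= n -> Phi <= C0 ^ 2 * n ^ 2 ->
  sigma * dPhi <= - (2 * c0 * n ^ 2) + C1 * (n * (e * (n + Rabs G))) ->
  Rabs (sigma * dG) <= C2 * (n + e * Rabs G) ->
  (M * e * G) ^ 2 < Phi ->
  sigma * (dPhi - 2 * M ^ 2 * e ^ 2 * G * dG) < 0.
Proof.
intros Hc0 HC0 HC1 HC2.
(* The quotient makes the mixed error [C1 * n * g] at most [c0 / 4 * n ^ 2]; the added 1 gives
   [M >= 1], hence [g <= C0 * n]. *)
set (M := 4 * C1 * C0 / c0 + 1).
assert (HM : 1 <= M).
  assert (0 < 4 * C1 * C0 / c0).
    apply Rdiv_lt_0_compat; auto; repeat apply Rmult_lt_0_compat; lra.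
  unfold M; lra.
assert (HMc : 4 * C1 * C0 <= c0 * M).
  unfold M; rewrite Rmult_plus_distr_l.
  replace (c0 * (4 * C1 * C0 / c0)) with (4 * C1 * C0) by (field; lra); lra.
(* [D] collects the coefficients of the errors of size [e * n ^ 2]. For [e < c0 / (2 * D)] they cost
   at most [c0 / 2 * n ^ 2], so all errors together use 3/4 of a budget of 2. *)
set (D := C1 + 2 * M * C0 * C2 * (1 + C0)).
assert (HD : C1 <= D).
  unfold D; assert (0 < 2 * M * C0 * C2 * (1 + C0)) by
    (repeat apply Rmult_lt_0_compat; lra); lra.
exists M, (c0 / (2 * D)); repeat split; try lra.
  apply Rdiv_lt_0_compat; lra.
intros e n G Phi sigma dPhi dG [He0 He] Hn HPhi HdPhi HdG Hout.
assert (HeD : e * D <= c0 / 2).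
  replace (c0 / 2) with (c0 / (2 * D) * D) by (field; lra).
  apply Rmult_le_compat_r; lra.
set (g := e * Rabs G).
assert (Hg : 0 <= g) by (apply Rmult_le_pos; auto; apply Rabs_pos).
(* Outside the cone the part along the kernel is dominated by the defects, with a factor [C0 / M]
   that a large aperture makes small. *)
assert (Hcone : M * g < C0 * n).
  apply Rsqr_incrst_0; unfold Rsqr; try (apply Rmult_le_pos; lra).
  apply Rle_lt_trans with ((M * e * G) ^ 2); [right |].
    unfold g; rewrite <- (pow2_abs (M * e * G)), !Rabs_mult.
    rewrite (Rabs_pos_eq M), (Rabs_pos_eq e) by lra; ring.
  lra.
assert (Hn' : 0 < n).
  destruct Hn as [Hn | <-]; auto.
  assert (0 <= M * g) by (apply Rmult_le_pos; lra); lra.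
assert (Hgn : g <= C0 * n).
  apply Rle_trans with (M * g); [| lra].
  rewrite <- (Rmult_1_l g) at 1; apply Rmult_le_compat_r; lra.
assert (HX : sigma * dPhi <= - (2 * c0 * n ^ 2) + C1 * e * n ^ 2 + C1 * n * g).
  apply Rle_trans with (1 := HdPhi); right; unfold g; ring.
assert (H1 : C1 * n * g <= c0 / 4 * n ^ 2).
  apply Rmult_le_reg_l with M; [lra |].
  apply Rle_trans with (C1 * n * (C0 * n)).
    replace (M * (C1 * n * g)) with (C1 * n * (M * g)) by ring.
    apply Rmult_le_compat_l; [apply Rmult_le_pos |]; lra.
  replace (C1 * n * (C0 * n)) with (C1 * C0 * n ^ 2) by ring.
  replace (M * (c0 / 4 * n ^ 2)) with (c0 * M / 4 * n ^ 2) by field.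
  apply Rmult_le_compat_r; [apply pow2_ge_0 | lra].
assert (H2 : Rabs (2 * M ^ 2 * e ^ 2 * G * (sigma * dG))
   <= e * (2 * M * C0 * C2 * (1 + C0)) * n ^ 2).
  rewrite Rabs_mult.
  replace (Rabs (2 * M ^ 2 * e ^ 2 * G)) with (2 * M * e * (M * g)).
  2:{ unfold g; rewrite !Rabs_mult, <- !RPow_abs, (Rabs_pos_eq 2), (Rabs_pos_eq M),
      (Rabs_pos_eq e) by lra; ring. }
  replace (e * (2 * M * C0 * C2 * (1 + C0)) * n ^ 2)
   with (2 * M * e * (C0 * n) * (C2 * (n + C0 * n))) by ring.
  apply Rmult_le_compat; try apply Rabs_pos.
  - repeat apply Rmult_le_pos; first [lra | apply Rabs_pos].
  - apply Rmult_le_compat_l; [repeat apply Rmult_le_pos |]; lra.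
  - apply Rle_trans with (1 := HdG); fold g; apply Rmult_le_compat_l; lra.
assert (H3 : e * D * n ^ 2 <= c0 / 2 * n ^ 2).
  apply Rmult_le_compat_r; [apply pow2_ge_0 | lra].
assert (Hpos : 0 < c0 * n ^ 2) by (apply Rmult_lt_0_compat; [lra | now apply pow_lt]).
replace (sigma * (dPhi - 2 * M ^ 2 * e ^ 2 * G * dG))
  with (sigma * dPhi - 2 * M ^ 2 * e ^ 2 * G * (sigma * dG)) by ring.
pose proof (Rle_abs (- (2 * M ^ 2 * e ^ 2 * G * (sigma * dG)))) as HA.
rewrite Rabs_Ropp in HA.
unfold D in H3; rewrite Rmult_plus_distr_l, Rmult_plus_distr_r in H3.
lra.
Qed.

(** * Uniform asymptotics for small shocks *)

(** Everything a bound must be uniform in forms a single index, so no choice of one profile per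
    strength is needed. *)
Record wave_point := WavePoint {
  right : state; vol_of : R -> R; vel_of : R -> R; temp_of : R -> R; place : R }.

Lemma family_sign_sqr (s : shock_family) : family_sign s ^ 2 = 1.
Proof. destruct s; simpl; ring. Qed.

Section SmallShocks.
Context (Rg gamma : R) (tau mu kappa : R -> R).
Context (Rg_pos : 0 < Rg) (gamma_gt1 : 1 < gamma).
Context (tauC2 : positive_C2 tau) (muC2 : positive_C2 mu) (kappaC2 : positive_C2 kappa).
Context (l : state) (l_adm : admissible l) (s : shock_family).

Let p0 := st_pressure Rg l.
Let cv := Rg / (gamma - 1).

Definition speed (i : wave_point) := sigma_eps Rg s l (right i).

Definition shock_wave (i : wave_point) : Prop :=
  admissible (right i) /\ lax s l (right i) /\
  profile_solution Rg gamma tau mu kappa l (right i) (speed i)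
    (vol_of i) (vel_of i) (temp_of i) /\
  monotone_profile s (vol_of i) (vel_of i) (temp_of i).

Definition strength (i : wave_point) := Rabs (vol l - vol (right i)).

(* Uniformity over all waves and all places is built into this filter. *)
Definition small_shocks (P : wave_point -> Prop) : Prop :=
  exists d, 0 < d /\ forall i, shock_wave i -> strength i < d -> P i.

Global Instance small_shocks_filter : Filter small_shocks.
Proof.
split.
- exists 1; split; [lra | auto].
- intros P Q [d [Hd HP]] [d' [Hd' HQ]]; exists (Rmin d d'); split.
    now apply Rmin_glb_lt.
  intros i Hi Hs; split.
    apply HP; auto; apply Rlt_le_trans with (1 := Hs), Rmin_l.
  apply HQ; auto; apply Rlt_le_trans with (1 := Hs), Rmin_r.
- intros P Q H [d [Hd HP]]; exists d; auto.
Qed.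

Lemma small_shocks_all (P : wave_point -> Prop) :
  (forall i, shock_wave i -> P i) -> small_shocks P.
Proof. intros H; exists 1; split; [lra | auto]. Qed.

Lemma strength_small (d : R) :
  0 < d -> small_shocks (fun i => Rabs (strength i) < d).
Proof.
intros Hd; exists d; split; auto; intros i _.
unfold strength; now rewrite Rabs_Rabsolu.
Qed.

Notation O := (bigO small_shocks).
Notation "f ~> c" := (approx small_shocks strength f c) (at level 70).

Definition vf i := vol_of i (place i).
Definition uf i := vel_of i (place i).
Definition tf i := temp_of i (place i).
Definition Gf i := Derive (vol_of i) (place i).
Definition Hf i := Derive (vel_of i) (place i).
Definition Kf i := Derive (temp_of i) (place i).
Definition Pf i := pressure Rg (vf i) (tf i).

Lemma vol_jump (i : wave_point) :
  shock_wave i ->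
  vol (right i) - vol l = family_sign s * strength i /\ 0 < strength i.
Proof.
intros (_ & Hlax & _); unfold strength.
destruct s; simpl in *; unfold Rabs; destruct (Rcase_abs _); lra.
Qed.

(** By definition the speed is a sign times a square root, which could be 0 (as [sqrt] is on
    negative reals). The strict sign comes from the first jump condition, where both jumps are
    nonzero. *)
Lemma speed_sign (i : wave_point) :
  shock_wave i -> 0 < family_sign s * speed i.
Proof.
intros Hi; destruct (vol_jump i Hi) as [EV HS].
destruct Hi as (Hr & Hlax & Hp & Hm).
destruct (profile_end Rg gamma tau mu kappa tauC2 muC2 kappaC2 l l_adm (right i) Hr _
  _ _ _ Hp p_infty (right i)) as (E1 & _); [right; auto |].
assert (Hu : vel (right i) < vel l) by (destruct s; simpl in Hlax; lra).
rewrite EV in E1.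
apply Rmult_lt_reg_r with (strength i); auto; lra.
Qed.

Lemma speed_sqrt (i : wave_point) : speed i = family_sign s * sqrt (speed i ^ 2).
Proof.
unfold speed, sigma_eps.
rewrite Rpow_mult_distr, family_sign_sqr, Rmult_1_l.
rewrite sqrt_pow2; auto using sqrt_pos.
Qed.

Lemma speed_sqr (i : wave_point) :
  shock_wave i ->
  speed i ^ 2 * (vol l + (gamma + 1) / 2 * (family_sign s * strength i)) = gamma * p0.
Proof.
intros Hi; destruct (vol_jump i Hi) as [EV HS]; rewrite <- EV.
pose proof (speed_sign i Hi).
destruct Hi as (Hr & Hlax & Hp & Hm).
apply (speed_relation Rg gamma tau mu kappa gamma_gt1 tauC2 muC2 kappaC2 l l_adm
  (right i) Hr (speed i) (vol_of i) (vel_of i) (temp_of i) Hp).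
- intros E; rewrite E in *; lra.
- destruct s; simpl in Hlax; lra.
Qed.

Lemma p0_pos : 0 < p0.
Proof.
destruct l_adm; unfold p0, st_pressure, pressure.
apply Rdiv_lt_0_compat; auto; now apply Rmult_lt_0_compat.
Qed.

Lemma cv_pos : 0 < cv.
Proof. apply Rdiv_lt_0_compat; lra. Qed.

Let sigma0 := sigma_star Rg gamma s l.

Lemma sigma_star_sqr : sigma0 ^ 2 = gamma * p0 / vol l.
Proof.
unfold sigma0, sigma_star; rewrite Rpow_mult_distr, family_sign_sqr, pow2_sqrt.
  fold p0; ring.
destruct l_adm; fold p0; left; pose proof p0_pos.
apply Rdiv_lt_0_compat; auto; apply Rmult_lt_0_compat; lra.
Qed.

Lemma sigma_star_sign : 0 < family_sign s * sigma0.
Proof.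
unfold sigma0, sigma_star; rewrite <- Rmult_assoc.
replace (family_sign s * family_sign s) with 1 by (rewrite <- (family_sign_sqr s); ring).
rewrite Rmult_1_l; apply sqrt_lt_R0.
destruct l_adm; pose proof p0_pos.
apply Rdiv_lt_0_compat; auto; apply Rmult_lt_0_compat; fold p0; lra.
Qed.

Lemma sigma_star_neq_0 : sigma0 <> 0.
Proof. pose proof sigma_star_sign as Hs; intros E; rewrite E in Hs; lra. Qed.

Lemma rate_A_pos : 0 < rate_A Rg gamma tau mu kappa s l.
Proof.
destruct l_adm as [pl pt]; pose proof sigma_star_neq_0 as Hs.
unfold rate_A; fold sigma0.
assert (0 < Rg * tau (temp l)) by
  (apply Rmult_lt_0_compat; auto; now apply positive_C2_pos).
assert (0 < Rg * gamma * mu (temp l)) by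
  (apply Rmult_lt_0_compat; [apply Rmult_lt_0_compat; lra | now apply positive_C2_pos]).
assert (0 < (gamma - 1) ^ 2 * kappa (temp l)) by
  (apply Rmult_lt_0_compat; [apply pow_lt; lra | now apply positive_C2_pos]).
apply Rmult_lt_0_compat; [| lra].
apply Rdiv_lt_0_compat; [| lra].
apply Rmult_lt_0_compat; [apply Rmult_lt_0_compat; lra | now apply Rabs_pos_lt].
Qed.

Ltac solve_approx :=
  match goal with
  | |- approx _ _ (fun _ => ?c) _ => apply (approx_const small_shocks strength c)
  | H : approx _ _ ?f _ |- approx _ _ ?f _ => exact H
  | H : approx _ _ ?f _ |- approx _ _ (fun i => ?f i) _ => exact H
  | |- approx _ _ (fun i => _ + _) _ =>
      eapply (approx_plus small_shocks strength); solve_approx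
  | |- approx _ _ (fun i => _ - _) _ =>
      eapply (approx_minus small_shocks strength); solve_approx
  | |- approx _ _ (fun i => - _) _ =>
      eapply (approx_opp small_shocks strength); solve_approx
  | |- approx _ _ (fun i => _ * _) _ =>
      eapply (approx_mult small_shocks strength strength_small); [ solve_approx ..]
  | |- approx _ _ (fun i => _ / _) _ =>
      eapply (approx_div small_shocks strength strength_small); [ | solve_approx ..]
  | |- approx _ _ (fun i => / _) _ =>
      eapply (approx_inv small_shocks strength strength_small); [ | solve_approx]
  end.

Lemma approx_value (f : wave_point -> R) (c d : R) : f ~> c -> c = d -> f ~> d.
Proof. now intros H <-. Qed.

Lemma approx_strength : strength ~> 0.
Proof.
apply (approx_small small_shocks), (bigO_le_loc small_shocks).
apply small_shocks_all; intros; apply Rle_refl.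
Qed.

Lemma approx_speed : speed ~> sigma0.
Proof.
pose proof p0_pos; destruct l_adm as [pl _].
apply (approx_ext_loc small_shocks) with
  (fun i => family_sign s * sqrt (gamma * p0
      / (vol l + (gamma + 1) / 2 * (family_sign s * strength i)))).
(* Below this strength the denominator exceeds [vol l / 2], also for a 1-shock, where the volume
   drops. *)
- destruct (strength_small (vol l / (gamma + 1))) as [d [Hd H1]].
    apply Rdiv_lt_0_compat; lra.
  exists d; split; auto; intros i Hi Hs.
  specialize (H1 i Hi Hs).
  rewrite (speed_sqrt i), <- (speed_sqr i Hi).
  do 2 f_equal; field.
  destruct (vol_jump i Hi) as [_ HS].
  rewrite Rabs_pos_eq in H1 by lra.
  assert (strength i * (gamma + 1) < vol l).
    replace (vol l) with (vol l / (gamma + 1) * (gamma + 1)) by (field; lra).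
    apply Rmult_lt_compat_r; lra.
  destruct s; simpl; nra.
- unfold sigma0, sigma_star; fold p0.
  pose proof approx_strength.
  apply (approx_mult small_shocks strength strength_small); [ solve_approx |].
  apply (approx_comp small_shocks strength strength_small sqrt).
    auto_derive; apply Rdiv_lt_0_compat; auto; apply Rmult_lt_0_compat; lra.
  eapply approx_value; [solve_approx |].
    lra.
  field; lra.
Qed.

(** * Bounds by the shock strength *)

Lemma vol_between (i : wave_point) :
  shock_wave i -> 0 < family_sign s * (vf i - vol l) < strength i.
Proof.
intros Hi; destruct (vol_jump i Hi) as [EV _].
destruct Hi as (Hr & Hlax & Hp & Hm).
assert (Hd := profile_derivable _ _ _ _ _ _ _ _ _ _ _ Hp).
destruct Hp as (_ & _ & _ & _ & _ & [Lv Rv] & _).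
unfold vf; destruct s; simpl in *.
- assert (Hv : vol (right i) < vol_of i (place i) < vol l).
    apply decreasing_between_limits; auto; intros z; [apply Hd | apply Hm].
  lra.
- assert (Hv : vol l < vol_of i (place i) < vol (right i)).
    apply increasing_between_limits; auto; intros z; [apply Hd | apply Hm].
  lra.
Qed.

Lemma vel_temp_between (i : wave_point) :
  shock_wave i ->
  Rabs (uf i - vel l) <= Rabs (vel (right i) - vel l) /\
  Rabs (tf i - temp l) <= Rabs (temp (right i) - temp l).
Proof.
intros (Hr & Hlax & Hp & Hm).
assert (Hd := profile_derivable _ _ _ _ _ _ _ _ _ _ _ Hp).
destruct Hp as (_ & _ & _ & _ & _ & _ & [Lu Ru] & [Lt Rt]).
unfold uf, tf; set (x := place i).
assert (Hu : vel (right i) < vel_of i x < vel l).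
  apply decreasing_between_limits; auto; intros z; [apply Hd |].
  destruct s; apply Hm.
split; [unfold Rabs; repeat destruct (Rcase_abs _); lra |].
destruct s; simpl in *.
- assert (Ht : temp l < temp_of i x < temp (right i)).
    apply increasing_between_limits; auto; intros z; [apply Hd | apply Hm].
  rewrite !Rabs_pos_eq; lra.
- assert (Ht : temp (right i) < temp_of i x < temp l).
    apply decreasing_between_limits; auto; intros z; [apply Hd | apply Hm].
  rewrite !Rabs_left1; lra.
Qed.

Lemma right_jumps (i : wave_point) :
  shock_wave i ->
  vel (right i) - vel l = - speed i * (family_sign s * strength i) /\
  temp (right i) - temp l
  = / cv * (speed i ^ 2 * strength i / 2 - p0 * family_sign s) * strength i.
Proof.
intros Hi; destruct (vol_jump i Hi) as [EV HS]; pose proof (speed_sign i Hi) as Hsg.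
destruct Hi as (Hr & Hlax & Hp & Hm).
destruct (profile_end Rg gamma tau mu kappa tauC2 muC2 kappaC2 l l_adm (right i) Hr _
  _ _ _ Hp p_infty (right i)) as (E1 & _ & E3 & _); [right; auto |].
fold p0 cv in E3; rewrite EV in E1.
assert (EU : vel (right i) - vel l = - speed i * (family_sign s * strength i)) by lra.
split; auto.
rewrite EU in E3; pose proof cv_pos.
apply Rmult_eq_reg_l with (speed i * cv).
- replace (speed i * cv * (temp (right i) - temp l))
    with (speed i * ((speed i * (family_sign s * strength i)) ^ 2 / 2)
          - p0 * speed i * (family_sign s * strength i)) by lra.
  rewrite !Rpow_mult_distr, family_sign_sqr; field; lra.
- intros E; apply Rmult_integral in E as [E | E]; [rewrite E in Hsg |]; lra.
Qed.

Lemma bigO_V : O (fun i => vf i - vol l) strength.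
Proof.
apply (bigO_le_loc small_shocks), small_shocks_all; intros i Hi.
rewrite (Rabs_pos_eq (strength i)) by apply Rabs_pos.
pose proof (vol_between i Hi) as HV.
destruct s; simpl in HV; unfold Rabs; destruct (Rcase_abs _); lra.
Qed.

Lemma bigO_strength_mult (k : wave_point -> R) (c : R) :
  k ~> c -> O (fun i => k i * strength i) strength.
Proof.
intros Hk; apply (bigO_bounded_mult small_shocks).
  now apply (approx_bounded small_shocks strength strength_small) with c.
apply (bigO_le_loc small_shocks), small_shocks_all; intros; apply Rle_refl.
Qed.

Lemma bigO_U : O (fun i => uf i - vel l) strength.
Proof.
pose proof approx_speed.
apply (bigO_trans small_shocks) with (fun i => - speed i * family_sign s * strength i).
- apply (bigO_le_loc small_shocks), small_shocks_all; intros i Hi.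
  rewrite Rmult_assoc, <- (proj1 (right_jumps i Hi)); now apply vel_temp_between.
- eapply bigO_strength_mult; solve_approx.
Qed.

Lemma bigO_T : O (fun i => tf i - temp l) strength.
Proof.
pose proof approx_speed; pose proof approx_strength; pose proof cv_pos.
apply (bigO_trans small_shocks) with
  (fun i => / cv * (speed i * speed i * strength i / 2 - p0 * family_sign s)
     * strength i).
- apply (bigO_le_loc small_shocks), small_shocks_all; intros i Hi.
  replace (speed i * speed i) with (speed i ^ 2) by ring.
  rewrite <- (proj2 (right_jumps i Hi)); now apply vel_temp_between.
- eapply bigO_strength_mult; solve_approx; lra.
Qed.

Lemma approx_vf : vf ~> vol l.
Proof. exact bigO_V. Qed.

Lemma approx_tf : tf ~> temp l.
Proof. exact bigO_T. Qed.

Lemma approx_transport (k : R -> R) :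
  positive_C2 k ->
  (fun i => k (tf i)) ~> k (temp l) /\
  (fun i => Derive k (tf i)) ~> Derive k (temp l) /\ 0 < k (temp l).
Proof.
intros Hk; destruct l_adm as [pl tl]; repeat split.
- apply (approx_comp small_shocks strength strength_small); [| exact approx_tf].
  now apply positive_C2_derivable.
- apply (approx_comp small_shocks strength strength_small); [| exact approx_tf].
  now apply positive_C2_derivable2.
- now apply positive_C2_pos.
Qed.

Lemma approx_Pf : Pf ~> p0.
Proof.
pose proof approx_vf; pose proof approx_tf; destruct l_adm.
unfold Pf, pressure, p0, st_pressure, pressure; solve_approx; lra.
Qed.

Ltac approx_facts :=
  pose proof approx_strength; pose proof approx_speed;
  pose proof approx_vf; pose proof approx_tf; pose proof approx_Pf;
  destruct (approx_transport tau tauC2) as (? & ? & ?);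
  destruct (approx_transport mu muC2) as (? & ? & ?);
  destruct (approx_transport kappa kappaC2) as (? & ? & ?);
  pose proof p0_pos; pose proof cv_pos; pose proof sigma_star_neq_0;
  assert (0 < vol l) by apply l_adm.

Lemma bounded_approx (f : wave_point -> R) (c : R) : f ~> c -> bounded small_shocks f.
Proof. apply (approx_bounded small_shocks strength strength_small). Qed.

Lemma approx_mult_bigO (k f g : wave_point -> R) (c : R) :
  k ~> c -> O f g -> O (fun i => k i * f i) g.
Proof.
intros Hk; apply (bigO_bounded_mult small_shocks); now apply bounded_approx with c.
Qed.

(** The integrated equation expresses the derivative through differences of states, which
    monotonicity confines to the size of the jumps. *)
Lemma bigO_G : O Gf strength.
Proof.
approx_facts.
apply (bigO_ext_loc small_shocks) with (fun i => vf i / tau (tf i)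
  * (- speed i * (vf i - vol l) - (uf i - vel l))).
- apply small_shocks_all; intros i (Hr & Hlax & Hp & Hm).
  pose proof (volume_integrated _ _ _ _ _ tauC2 l l_adm _ Hr _ _ _ _ Hp (place i)) as E.
  unfold volume_flux in E; fold (vf i) (uf i) (tf i) (Gf i) in E; rewrite <- E.
  destruct (profile_pos _ _ _ _ _ _ _ _ _ _ _ Hp (place i)) as [pv pt].
  pose proof (positive_C2_pos _ _ tauC2 pt) as pk.
  fold (vf i) in pv |- *; fold (tf i) in pk |- *; field; lra.
- eapply approx_mult_bigO; [solve_approx; lra |].
  apply (bigO_minus small_shocks); [| exact bigO_U].
  eapply approx_mult_bigO; [solve_approx | exact bigO_V].
Qed.

Lemma bigO_K : O Kf strength.
Proof.
approx_facts.
apply (bigO_ext_loc small_shocks) with (fun i => vf i / kappa (tf i)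
  * (- speed i * (cv * (tf i - temp l) - (uf i - vel l) / 2 * (uf i - vel l))
     + p0 * (uf i - vel l))).
- apply small_shocks_all; intros i (Hr & Hlax & Hp & Hm).
  pose proof (thermal_integrated _ _ _ _ _ muC2 kappaC2 l l_adm _ Hr _ _ _ _ Hp
    (place i)) as E.
  unfold thermal_flux in E; fold p0 cv in E; fold (uf i) (tf i) (Kf i) in E.
  replace ((uf i - vel l) / 2 * (uf i - vel l)) with ((uf i - vel l) ^ 2 / 2) by field.
  rewrite <- E.
  destruct (profile_pos _ _ _ _ _ _ _ _ _ _ _ Hp (place i)) as [pv pt].
  pose proof (positive_C2_pos _ _ kappaC2 pt) as pk.
  fold (vf i) in pv |- *; fold (tf i) in pk |- *; field; lra.
- assert (uf ~> vel l) by exact bigO_U.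
  eapply approx_mult_bigO; [solve_approx; lra |].
  apply (bigO_plus small_shocks).
  + eapply approx_mult_bigO; [solve_approx |].
    apply (bigO_minus small_shocks).
      eapply approx_mult_bigO; [solve_approx | exact bigO_T].
    eapply approx_mult_bigO; [solve_approx; lra | exact bigO_U].
  + eapply approx_mult_bigO; [solve_approx | exact bigO_U].
Qed.


(** * Error terms relative to the derivative vector *)

Definition r1f i := defect1 (speed i) (vol_of i) (vel_of i) (place i).
Definition r3f i := defect3 Rg gamma l (speed i) (vel_of i) (temp_of i) (place i).
Definition nf i := Rabs (r1f i) + Rabs (r3f i).
Definition zf i := nf i + Rabs (Gf i).

Lemma nf_pos (i : wave_point) : 0 <= nf i.
Proof. apply Rplus_le_le_0_compat; apply Rabs_pos. Qed.

Lemma bigO_abs_le (f g : wave_point -> R) :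
  (forall i, shock_wave i -> Rabs (f i) <= g i) -> O f g.
Proof.
intros H; apply (bigO_le_loc small_shocks), small_shocks_all; intros i Hi.
apply Rle_trans with (g i); auto using Rle_abs.
Qed.

Lemma bigO_r1 : O r1f nf.
Proof.
apply bigO_abs_le; intros i _; unfold nf; pose proof (Rabs_pos (r3f i)); lra.
Qed.

Lemma bigO_r3 : O r3f nf.
Proof.
apply bigO_abs_le; intros i _; unfold nf; pose proof (Rabs_pos (r1f i)); lra.
Qed.

Lemma bigO_nz : O nf zf.
Proof.
apply bigO_abs_le; intros i _; rewrite Rabs_pos_eq by apply nf_pos.
unfold zf; pose proof (Rabs_pos (Gf i)); lra.
Qed.

Lemma bigO_Gz : O Gf zf.
Proof.
apply bigO_abs_le; intros i _; unfold zf; pose proof (nf_pos i); lra.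
Qed.

Lemma bigO_Hz : O Hf zf.
Proof.
approx_facts.
apply (bigO_ext_loc small_shocks) with (fun i => - speed i * Gf i - r1f i).
  apply small_shocks_all; intros i _; unfold r1f, defect1, Gf, Hf; ring.
apply (bigO_minus small_shocks).
  eapply approx_mult_bigO; [solve_approx | exact bigO_Gz].
apply (bigO_trans small_shocks) with nf; [exact bigO_r1 | exact bigO_nz].
Qed.

Lemma bigO_Kz : O Kf zf.
Proof.
approx_facts.
apply (bigO_ext_loc small_shocks)
  with (fun i => / speed i * (/ cv * (p0 * Hf i - r3f i))).
  apply small_shocks_all; intros i Hi; unfold r3f, defect3, Kf, Hf; fold p0 cv.
  pose proof (speed_sign i Hi) as Hs.
  field; split; [lra |]; intros E; rewrite E in Hs; lra.
eapply approx_mult_bigO; [solve_approx; auto |].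
eapply approx_mult_bigO; [solve_approx; lra |].
apply (bigO_minus small_shocks).
  eapply approx_mult_bigO; [solve_approx | exact bigO_Hz].
apply (bigO_trans small_shocks) with nf; [exact bigO_r3 | exact bigO_nz].
Qed.

Definition relvar (k : R -> R) i :=
  relative_variation (vol_of i) (temp_of i) k (place i).

Lemma bigO_relvar (k : R -> R) : positive_C2 k -> O (relvar k) strength.
Proof.
intros Hk; approx_facts.
destruct (approx_transport k Hk) as (? & ? & ?).
apply (bigO_ext_loc small_shocks) with
  (fun i => / vf i * Gf i - Derive k (tf i) / k (tf i) * Kf i).
  apply small_shocks_all; intros i Hi.
  unfold relvar, relative_variation; fold (vf i) (tf i) (Gf i) (Kf i).
  unfold Rdiv; ring.
apply (bigO_minus small_shocks).
  eapply approx_mult_bigO; [solve_approx; lra | exact bigO_G].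
eapply approx_mult_bigO; [solve_approx; lra | exact bigO_K].
Qed.

(** The size of a quadratic error: one factor small with the shock, one comparable to the derivative
    vector. Keeping the second factor preserves the estimate near the ends, where the vector tends
    to 0. *)
Definition sz i := strength i * zf i.

Definition verr i :=
  velocity_error Rg gamma mu l (speed i) (vol_of i) (vel_of i) (temp_of i) (place i).

Lemma bigO_verr : O verr sz.
Proof.
approx_facts.
apply (bigO_ext_loc small_shocks) with (fun i =>
  vf i / mu (tf i)
    * ((- (speed i * speed i) + (gamma - 1) * p0 / vf i + Pf i / vf i) * Hf i)
  + / mu (tf i) * ((Pf i - p0) * r1f i) + speed i * (relvar mu i * Hf i)).
  apply small_shocks_all; intros i _; unfold verr, velocity_error, relvar, r1f.
  fold p0 (vf i) (tf i) (Pf i) (Hf i); ring.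
apply (bigO_plus small_shocks); [apply (bigO_plus small_shocks) |].
- eapply approx_mult_bigO; [solve_approx; lra |].
  apply (bigO_mult small_shocks); [| exact bigO_Hz].
  assert (D : (fun i =>
    - (speed i * speed i) + (gamma - 1) * p0 / vf i + Pf i / vf i) ~> 0).
    eapply approx_value; [solve_approx; lra |].
    replace (sigma0 * sigma0) with (sigma0 ^ 2) by ring.
    rewrite sigma_star_sqr; field; lra.
  revert D; apply (bigO_ext_loc small_shocks), small_shocks_all; intros; ring.
- eapply approx_mult_bigO; [solve_approx; lra |].
  apply (bigO_mult small_shocks); [exact approx_Pf |].
  apply (bigO_trans small_shocks) with nf; [exact bigO_r1 | exact bigO_nz].
- eapply approx_mult_bigO; [solve_approx |].
  apply (bigO_mult small_shocks); [apply bigO_relvar; auto | exact bigO_Hz].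
Qed.

Definition lerr i :=
  lyapunov_error Rg gamma tau mu kappa l (speed i) (vol_of i) (vel_of i) (temp_of i)
    (place i).

Lemma bigO_lerr : O lerr (fun i => nf i * sz i).
Proof.
approx_facts.
apply (bigO_ext_loc small_shocks) with (fun i =>
  p0 ^ 2 * (r1f i * (- (speed i * speed i) * (relvar tau i * Gf i) - verr i))
  + (gamma - 1) * (r3f i *
     (- (speed i * speed i * cv)
        * (vf i / kappa (tf i) * speed i * ((uf i - vel l) * Hf i)
          + relvar kappa i * Kf i) + p0 * verr i))).
  apply small_shocks_all; intros i _; unfold lerr, lyapunov_error.
  fold (verr i) (relvar tau i) (relvar kappa i) (r1f i) (r3f i).
  fold p0 cv (vf i) (tf i) (uf i) (Gf i) (Hf i) (Kf i); ring.
apply (bigO_plus small_shocks).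
- eapply approx_mult_bigO; [solve_approx |].
  apply (bigO_mult small_shocks); [exact bigO_r1 |].
  apply (bigO_minus small_shocks); [| exact bigO_verr].
  eapply approx_mult_bigO; [solve_approx |].
  apply (bigO_mult small_shocks); [now apply bigO_relvar | exact bigO_Gz].
- eapply approx_mult_bigO; [solve_approx |].
  apply (bigO_mult small_shocks); [exact bigO_r3 |].
  apply (bigO_plus small_shocks).
  + eapply approx_mult_bigO; [solve_approx |].
    apply (bigO_plus small_shocks).
      eapply approx_mult_bigO; [solve_approx; lra |].
      apply (bigO_mult small_shocks); [exact bigO_U | exact bigO_Hz].
    apply (bigO_mult small_shocks); [now apply bigO_relvar | exact bigO_Kz].
  + eapply approx_mult_bigO; [solve_approx | exact bigO_verr].
Qed.

(** The defects enter at full size here. This is harmless in the cone argument, where [Derive G] is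
    multiplied by the square of the strength. *)
Lemma bigO_speed_derive_G :
  O (fun i => speed i * Derive (Derive (vol_of i)) (place i))
    (fun i => nf i + strength i * Rabs (Gf i)).
Proof.
approx_facts.
apply (bigO_ext_loc small_shocks) with (fun i =>
  speed i * (vf i / tau (tf i) * r1f i + relvar tau i * Gf i)).
  apply small_shocks_all; intros i (Hr & _ & Hp & _).
  now rewrite (derive_G _ _ _ _ _ tauC2 _ l_adm _ Hr _ _ _ _ Hp (place i)).
assert (Hpos : forall i, 0 <= strength i * Rabs (Gf i)).
  intros i; apply Rmult_le_pos; apply Rabs_pos.
eapply approx_mult_bigO; [solve_approx |].
apply (bigO_plus small_shocks).
- eapply approx_mult_bigO; [solve_approx; lra |].
  apply (bigO_trans small_shocks) with nf; [exact bigO_r1 |].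
  apply bigO_abs_le; intros i _; rewrite Rabs_pos_eq by apply nf_pos.
  specialize (Hpos i); lra.
- apply (bigO_trans small_shocks) with (fun i => strength i * Gf i).
    apply (bigO_mult small_shocks); [now apply bigO_relvar |].
    apply (bigO_le_loc small_shocks), small_shocks_all; intros; apply Rle_refl.
  apply bigO_abs_le; intros i _; rewrite Rabs_mult, (Rabs_pos_eq (strength i)).
    pose proof (nf_pos i); lra.
  apply Rabs_pos.
Qed.

(** * Dissipation and the cone estimate *)

Definition lyap i :=
  lyapunov Rg gamma l (speed i) (vol_of i) (vel_of i) (temp_of i) (place i).

Lemma lyap_le (i : wave_point) : lyap i <= (p0 + gamma) ^ 2 * nf i ^ 2.
Proof.
pose proof p0_pos; unfold lyap, lyapunov; fold p0 (r1f i) (r3f i); unfold nf.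
rewrite <- (pow2_abs (r1f i)), <- (pow2_abs (r3f i)).
pose proof (Rabs_pos (r1f i)); pose proof (Rabs_pos (r3f i)).
set (a := Rabs (r1f i)) in *; set (b := Rabs (r3f i)) in *.
assert (0 <= a * b) by now apply Rmult_le_pos.
assert (0 <= p0 * gamma) by (apply Rmult_le_pos; lra).
apply Rle_trans with ((p0 + gamma) ^ 2 * a ^ 2 + (p0 + gamma) ^ 2 * b ^ 2).
  apply Rplus_le_compat; apply Rmult_le_compat_r; try apply pow2_ge_0; nra.
rewrite <- Rmult_plus_distr_l; apply Rmult_le_compat_l; [apply pow2_ge_0 | nra].
Qed.

Lemma dissipation_ge :
  exists c0, 0 < c0 /\ small_shocks (fun i => c0 * nf i ^ 2 <=
    dissipation Rg gamma tau mu kappa l (speed i) (vol_of i) (vel_of i) (temp_of i)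
      (place i)).
Proof.
approx_facts.
assert (Hsq : 0 < sigma0 * sigma0) by now apply Rsqr_pos_lt.
set (a := sigma0 * sigma0 * (p0 ^ 2 * (vol l / tau (temp l)))).
set (b := sigma0 * sigma0 * ((gamma - 1) * cv * (vol l / kappa (temp l)))).
assert (Ha : 0 < a).
  unfold a; apply Rmult_lt_0_compat; auto; apply Rmult_lt_0_compat.
    now apply pow_lt.
  now apply Rdiv_lt_0_compat.
assert (Hb : 0 < b).
  unfold b; apply Rmult_lt_0_compat; auto; apply Rmult_lt_0_compat.
    apply Rmult_lt_0_compat; lra.
  now apply Rdiv_lt_0_compat.
assert (La :
  (fun i => speed i * speed i * (p0 ^ 2 * (vf i / tau (tf i)))) ~> a).
  unfold a; solve_approx; lra.
assert (Lb :
  (fun i => speed i * speed i * ((gamma - 1) * cv * (vf i / kappa (tf i)))) ~> b).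
  unfold b; solve_approx; lra.
(* Half the smaller limit lies strictly below both coefficients of the squared defects; the further
   half in the witness pays for [nf ^ 2 <= 2 * (r1f ^ 2 + r3f ^ 2)]. *)
set (c := Rmin a b / 2).
assert (Hc : 0 < c /\ c < a /\ c < b).
  assert (0 < Rmin a b) by now apply Rmin_pos.
  pose proof (Rmin_l a b); pose proof (Rmin_r a b); unfold c; lra.
exists (c / 2); split; [lra |].
destruct Hc as (Hc & Hca & Hcb).
destruct (approx_transport mu muC2) as (Lmu & _ & Hmu).
pose proof (approx_gt small_shocks strength strength_small) as gt.
generalize (filter_and _ _ (gt _ _ _ La Hca)
  (filter_and _ _ (gt _ _ _ Lb Hcb) (gt _ _ _ Lmu Hmu))).
apply filter_imp; intros i (I1 & I2 & I3).
unfold dissipation; fold p0 cv (r1f i) (r3f i) (vf i) (tf i).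
assert (D : 0 <= p0 / mu (tf i) * (p0 * r1f i - (gamma - 1) * r3f i) ^ 2).
  apply Rmult_le_pos; [| apply pow2_ge_0].
  left; now apply Rdiv_lt_0_compat.
assert (N : nf i ^ 2 <= 2 * (r1f i ^ 2 + r3f i ^ 2)).
  unfold nf; rewrite <- (pow2_abs (r1f i)), <- (pow2_abs (r3f i)).
  pose proof (pow2_ge_0 (Rabs (r1f i) - Rabs (r3f i))); lra.
assert (J1 := Rmult_le_compat_r _ _ _ (pow2_ge_0 (r1f i)) (Rlt_le _ _ I1)).
assert (J2 := Rmult_le_compat_r _ _ _ (pow2_ge_0 (r3f i)) (Rlt_le _ _ I2)).
assert (J3 := Rmult_le_compat_l (c / 2) _ _ ltac:(lra) N).
cbv beta in J1, J2; lra.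
Qed.

(** The maximum principle moves along one fixed wave. Every point of it is again an index of the
    same strength, so the uniform estimates hold there with the same thresholds. *)
Definition at_place i x := WavePoint (right i) (vol_of i) (vel_of i) (temp_of i) x.

Lemma lyap_cone :
  exists M, small_shocks (fun i => lyap i <= (M * strength i * Gf i) ^ 2).
Proof.
destruct dissipation_ge as [c0 [Hc0 [d1 [Hd1 H1]]]].
destruct (bigO_pos _ _ _ bigO_lerr) as [C1 [HC1 [d2 [Hd2 H2]]]].
destruct (bigO_pos _ _ _ bigO_speed_derive_G) as [C2 [HC2 [d3 [Hd3 H3]]]].
assert (HC0 : 0 < p0 + gamma) by (pose proof p0_pos; lra).
destruct (cone_exit c0 (p0 + gamma) (2 * C1) C2) as [M [d [HM [Hd Hexit]]]]; try lra.
exists M, (Rmin d (Rmin d1 (Rmin d2 d3))); split.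
  repeat apply Rmin_glb_lt; auto.
intros i Hi Hs.
assert (strength i < d /\ strength i < d1 /\ strength i < d2 /\ strength i < d3)
  as (Sd & S1 & S2 & S3).
  repeat split; apply Rlt_le_trans with (1 := Hs).
  - apply Rmin_l.
  - apply Rle_trans with (1 := Rmin_r _ _), Rmin_l.
  - apply Rle_trans with (1 := Rmin_r _ _), Rle_trans with (1 := Rmin_r _ _), Rmin_l.
  - apply Rle_trans with (1 := Rmin_r _ _), Rle_trans with (1 := Rmin_r _ _), Rmin_r.
set (L := lyapunov Rg gamma l (speed i) (vol_of i) (vel_of i) (temp_of i)).
(* The excess over the cone along the whole orbit; a positive value would force a critical point
   with positive value, which [cone_exit] rules out. *)
set (Psi x := L x - (M * strength i * Derive (vol_of i) x) ^ 2).
enough (HPsi : forall x, Psi x <= 0).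
  specialize (HPsi (place i)); unfold Psi, L in HPsi; unfold lyap, Gf; lra.
destruct Hi as (Hr & Hlax & Hp & Hm).
assert (HD : forall x, exists dL, is_derive Psi x (dL - 2 * M ^ 2 * strength i ^ 2
     * Derive (vol_of i) x * Derive (Derive (vol_of i)) x) /\
   speed i * dL = - (2 * dissipation Rg gamma tau mu kappa l (speed i)
       (vol_of i) (vel_of i) (temp_of i) x) + 2 * lerr (at_place i x)).
  intros x.
  destruct (lyapunov_is_derive _ _ _ _ _ gamma_gt1 tauC2 muC2 kappaC2 l l_adm _ Hr
    _ _ _ _ Hp x) as [dL [H4 H5]].
  exists dL; split; [| exact H5].
  destruct (profile_derivable _ _ _ _ _ _ _ _ _ _ _ Hp x) as [_ [Hv _]].
  apply (is_derive_minus (K := R_AbsRing) (V := R_NormedModule) L _ x dL); auto.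
  auto_derive; auto.
  rewrite (Derive_ext (fun x => Derive (vol_of i) x) (Derive (vol_of i))) by reflexivity.
  ring.
assert (Hlim : forall z w, end_value l (right i) z w -> is_lim Psi z 0).
  intros z w Hz.
  pose proof (lyapunov_end _ gamma _ _ _ tauC2 muC2 kappaC2 l l_adm _ Hr
    _ _ _ _ Hp z w Hz) as HL; fold L in HL.
  destruct (profile_end _ _ _ _ _ tauC2 muC2 kappaC2 l l_adm _ Hr
    _ _ _ _ Hp z w Hz) as (_ & _ & _ & LG & _).
  apply is_lim_ext with (fun x => L x - (M * strength i * Derive (vol_of i) x)
     * (M * strength i * Derive (vol_of i) x)).
    intros x; unfold Psi; ring.
  eapply is_lim_value; [solve_lim | ring].
apply nonpos_of_no_positive_critical.
- intros x; destruct (HD x) as [dL [H4 _]]; eexists; exact H4.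
- apply Hlim with l; left; auto.
- apply Hlim with (right i); right; auto.
- intros x Hx Hcrit.
  destruct (HD x) as [dL [H4 H5]].
  apply is_derive_unique in H4; rewrite Hcrit in H4.
  set (j := at_place i x).
  assert (Hj : shock_wave j) by (split; auto).
  assert (Hz : 0 <= nf j * sz j).
    apply Rmult_le_pos; [apply nf_pos |].
    apply Rmult_le_pos; [apply Rabs_pos |].
    apply Rplus_le_le_0_compat; [apply nf_pos | apply Rabs_pos].
  specialize (H1 j Hj S1); specialize (H2 j Hj S2); specialize (H3 j Hj S3).
  rewrite (Rabs_pos_eq _ Hz) in H2.
  (* A strict sign after multiplication by the speed excludes a zero derivative, whatever the sign
     of the speed. *)
  enough (speed i * (dL - 2 * M ^ 2 * strength i ^ 2 * Derive (vol_of i) x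
     * Derive (Derive (vol_of i)) x) < 0) as H6.
    rewrite <- H4 in H6; lra.
  apply (Hexit (strength j) (nf j) (Derive (vol_of i) x) (lyap j)).
  + split; auto; apply Rabs_pos.
  + apply nf_pos.
  + apply lyap_le.
  + rewrite H5; fold j.
    pose proof (Rle_abs (lerr j)).
    change (strength j * (nf j + Rabs (Derive (vol_of i) x))) with (sz j).
    change (dissipation Rg gamma tau mu kappa l (speed j)
      (vol_of j) (vel_of j) (temp_of j) (place j)) with
      (dissipation Rg gamma tau mu kappa l (speed i)
      (vol_of i) (vel_of i) (temp_of i) x) in H1.
    lra.
  + rewrite (Rabs_pos_eq (nf j + _)) in H3; [exact H3 |].
    apply Rplus_le_le_0_compat; [apply nf_pos |].
    apply Rmult_le_pos; apply Rabs_pos.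
  + unfold Psi in Hx; change (lyap j) with (L x); change (strength j) with (strength i).
    lra.
Qed.


(** * Slopes of the profile and the limiting rate *)

Lemma Gf_neq_0 (i : wave_point) : shock_wave i -> Gf i <> 0.
Proof.
intros (_ & _ & _ & Hm); unfold Gf.
destruct s; specialize (Hm (place i)); simpl in Hm; lra.
Qed.

Lemma approx_ratio_of_sqr_le (f : wave_point -> R) (c M : R) :
  0 < c -> small_shocks (fun i => c * f i ^ 2 <= (M * strength i * Gf i) ^ 2) ->
  (fun i => f i / Gf i) ~> 0.
Proof.
intros Hc H; apply (approx_small small_shocks).
exists (Rabs M / sqrt c).
assert (Hq : 0 < sqrt c) by now apply sqrt_lt_R0.
generalize (filter_and _ _ H (small_shocks_all _ Gf_neq_0)).
apply filter_imp; intros i [H1 HG].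
assert (H2 : sqrt c * Rabs (f i) <= Rabs M * Rabs (strength i) * Rabs (Gf i)).
  rewrite <- (Rabs_pos_eq (sqrt c)), <- !Rabs_mult by lra.
  apply Rsqr_le_abs_0.
  rewrite !Rsqr_pow2, Rpow_mult_distr, pow2_sqrt by lra; exact H1.
assert (HG' : 0 < Rabs (Gf i)) by now apply Rabs_pos_lt.
unfold Rdiv at 1; rewrite Rabs_mult, Rabs_inv.
apply Rmult_le_reg_r with (sqrt c * Rabs (Gf i)); [now apply Rmult_lt_0_compat |].
field_simplify; lra.
Qed.

(* The cone condition aligns the orbit, up to O(strength), with the kernel of the
   linearization of the integrated system at the left state. *)
Lemma approx_slopes :
  (fun i => Hf i / Gf i) ~> - sigma0 /\ (fun i => Kf i / Gf i) ~> - p0 / cv.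
Proof.
approx_facts.
destruct lyap_cone as [M HM].
assert (L1 : (fun i => r1f i / Gf i) ~> 0).
  apply (approx_ratio_of_sqr_le r1f (p0 ^ 2) M); [now apply pow_lt |].
  revert HM; apply filter_imp; intros i; apply Rle_trans.
  unfold lyap, lyapunov; fold p0 (r1f i) (r3f i).
  assert (0 <= (gamma - 1) * r3f i ^ 2) by
    (apply Rmult_le_pos; [lra | apply pow2_ge_0]); lra.
assert (L3 : (fun i => r3f i / Gf i) ~> 0).
  apply (approx_ratio_of_sqr_le r3f (gamma - 1) M); [lra |].
  revert HM; apply filter_imp; intros i; apply Rle_trans.
  unfold lyap, lyapunov; fold p0 (r1f i) (r3f i).
  assert (0 <= p0 ^ 2 * r1f i ^ 2) by
    (apply Rmult_le_pos; apply pow2_ge_0); lra.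
assert (LH : (fun i => Hf i / Gf i) ~> - sigma0).
  apply (approx_ext_loc small_shocks) with (fun i => - speed i - r1f i / Gf i).
    apply small_shocks_all; intros i Hi; pose proof (Gf_neq_0 i Hi).
    unfold r1f, defect1; fold (Gf i) (Hf i); field; auto.
  eapply approx_value; [solve_approx | ring].
split; [exact LH |].
apply (approx_ext_loc small_shocks) with
  (fun i => (p0 * (Hf i / Gf i) - r3f i / Gf i) / (speed i * cv)).
  apply small_shocks_all; intros i Hi; pose proof (Gf_neq_0 i Hi).
  pose proof (speed_sign i Hi) as Hs.
  unfold r3f, defect3; fold p0 cv (Hf i) (Kf i); field; repeat split; auto; try lra.
  intros E; rewrite E in Hs; lra.
assert (sigma0 * cv <> 0) by (apply Rmult_integral_contrapositive_currified; lra).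
eapply approx_value; [solve_approx; auto | field; lra].
Qed.

(** This is y'/(y(1-y)) divided by the strength: [1 - y] is the remaining volume jump over the
    signed strength. An O(strength) error here therefore becomes the quadratic error for y. *)
Definition rate i :=
  family_sign s * Gf i / ((vf i - vol l) * (vol (right i) - vf i)).

Lemma approx_rate : rate ~> rate_A Rg gamma tau mu kappa s l.
Proof.
approx_facts; destruct approx_slopes as [LH LK].
pose proof (approx_small small_shocks strength _ bigO_G) as LG.
set (N i := (gamma - 1) * (speed i * tau (tf i) * (vf i - vol l) / vf i
       + tau (tf i) * tau (tf i) * Gf i / (2 * (vf i * vf i)))
   - (gamma - 1) * p0 * tau (tf i) / (speed i * vf i)
   - (gamma - 1) * kappa (tf i) * (Kf i / Gf i) / (speed i * vf i)
   + speed i * tau (tf i) - mu (tf i) * (Hf i / Gf i)).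
set (D := Rg * tau (temp l) + Rg * gamma * mu (temp l)
  + (gamma - 1) ^ 2 * kappa (temp l)).
assert (HD : 0 < D).
  assert (0 < Rg * tau (temp l)) by now apply Rmult_lt_0_compat.
  assert (0 < Rg * gamma * mu (temp l)) by (repeat apply Rmult_lt_0_compat; lra).
  assert (0 < (gamma - 1) ^ 2 * kappa (temp l)) by
    (apply Rmult_lt_0_compat; auto; apply pow_lt; lra).
  unfold D; lra.
(* With [p0] traded for [sigma0], the limiting coefficients of [tau], [mu] and [kappa] in [N] become
   [sigma0] times 1/gamma, 1 and (gamma-1)^2/(gamma Rg): this is the origin of the denominator of
   A. *)
assert (Hp0 : p0 = sigma0 ^ 2 * vol l / gamma) by (rewrite sigma_star_sqr; field; lra).
assert (LN : N ~> sigma0 * D / (gamma * Rg)).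
  assert (sigma0 * vol l <> 0) by (apply Rmult_integral_contrapositive_currified; lra).
  assert (0 < 2 * (vol l * vol l)) by (repeat apply Rmult_lt_0_compat; lra).
  eapply approx_value; [unfold N; solve_approx; auto; lra |].
  unfold D, cv; rewrite Hp0; field; repeat split; auto; lra.
assert (HN0 : sigma0 * D / (gamma * Rg) <> 0).
  apply Rmult_integral_contrapositive_currified.
    apply Rmult_integral_contrapositive_currified; lra.
  apply Rinv_neq_0_compat, Rmult_integral_contrapositive_currified; lra.
apply (approx_ext_loc small_shocks) with
  (fun i => family_sign s * ((gamma + 1) / 2) * (speed i * speed i) / N i).
- generalize (filter_and _ _
    (approx_close small_shocks strength strength_small _ _ _ LN (Rabs_pos_lt _ HN0))
    (small_shocks_all _ (fun i Hi => Hi))).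
  apply filter_imp; intros i [HN Hi].
  assert (HNi : N i <> 0).
    intros E; rewrite E, Rminus_0_l, Rabs_Ropp in HN; lra.
  pose proof (Gf_neq_0 i Hi) as HG; pose proof (speed_sign i Hi) as Hs.
  destruct (vol_jump i Hi) as [EV HS].
  destruct Hi as (Hr & Hlax & Hp & Hm).
  assert (ER := volume_rate _ _ _ _ _ gamma_gt1 tauC2 muC2 kappaC2 l l_adm _ Hr
    _ _ _ _ Hp (place i) (Hf i / Gf i) (Kf i / Gf i)).
  fold p0 (vf i) (tf i) (Gf i) (Hf i) (Kf i) in ER.
  set (W := (vf i - vol l) * (vol (right i) - vf i)).
  assert (ER' : N i * Gf i = (gamma + 1) / 2 * speed i ^ 2 * W).
    replace ((gamma + 1) / 2 * speed i ^ 2 * W) with ((gamma + 1) / 2 * speed i ^ 2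
      * (vf i - vol l) * (vol (right i) - vf i)) by (unfold W; ring).
    rewrite <- ER.
    + unfold N; f_equal; simpl; rewrite !Rmult_1_r; reflexivity.
    + intros E; rewrite E in Hs; lra.
    + destruct s; simpl in Hlax; lra.
    + field; auto.
    + field; auto.
  assert (HW : W <> 0).
    intros E; rewrite E, Rmult_0_r in ER'.
    apply Rmult_integral in ER' as [? | ?]; auto.
  unfold rate; fold W.
  apply Rmult_eq_reg_r with (N i * W);
    [| now apply Rmult_integral_contrapositive_currified].
  transitivity (family_sign s * ((gamma + 1) / 2 * speed i ^ 2 * W)).
    field; auto.
  rewrite <- ER'; field; auto.
- eapply approx_value; [solve_approx; auto |].
  unfold rate_A; fold sigma0 D.
  rewrite <- (Rmult_1_l (Rabs sigma0)).
  replace (1 * Rabs sigma0) with (family_sign s * sigma0).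
    field; repeat split; auto; lra.
  pose proof sigma_star_sign.
  rewrite <- (Rabs_pos_eq (family_sign s * sigma0)), Rabs_mult by lra.
  f_equal; destruct s; simpl; [rewrite Rabs_left | rewrite Rabs_right]; lra.
Qed.

End SmallShocks.

Theorem corollary1p1 :
  forall (Rg gamma : R) (tau mu kappa : R -> R),
  0 < Rg -> 1 < gamma ->
  positive_C2 tau -> positive_C2 mu -> positive_C2 kappa ->
  forall l : state, admissible l ->
  exists eps0 C : R, 0 < eps0 /\ 0 < C /\
  forall (s : shock_family) (r : state),
  admissible r ->
  (exists sigma : R, rankine_hugoniot Rg gamma l r sigma) ->
  lax s l r ->
  let eps := Rabs (vol l - vol r) in
  0 < eps < eps0 ->
  forall v u th : R -> R,
  profile_solution Rg gamma tau mu kappa l r (sigma_eps Rg s l r) v u th ->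
  monotone_profile s v u th ->
  v 0 = (vol l + vol r) / 2 ->
  let A := rate_A Rg gamma tau mu kappa s l in
  let y := normalized_volume s l eps v in
  0 < A /\
  forall xi : R,
    Rabs (1 / (y xi * (1 - y xi)) * Derive y xi - A * eps) <= C * eps ^ 2.
Proof.
intros Rg gamma tau mu kappa HRg Hgamma Htau Hmu Hkappa l Hl.
assert (Hrate : forall s, exists C, 0 < C /\ small_shocks Rg gamma tau mu kappa l s
    (fun i => Rabs (rate l s i - rate_A Rg gamma tau mu kappa s l)
              <= C * Rabs (strength l i))).
  intros s; apply (bigO_pos _ _ _).
  now apply approx_rate.
destruct (Hrate Shock1) as [C1 [HC1 [d1 [Hd1 H1]]]].
destruct (Hrate Shock3) as [C3 [HC3 [d3 [Hd3 H3]]]].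
(* The constants are chosen before the shock family is known, so they must serve both. *)
exists (Rmin d1 d3), (Rmax C1 C3).
split; [now apply Rmin_glb_lt |].
split; [apply Rlt_le_trans with C1; auto using Rmax_l |].
intros s r Hr _ Hlax eps [Heps0 Heps] v u th Hp Hm _ A y.
split; [now apply rate_A_pos |].
intros xi.
set (i := WavePoint r v u th xi).
assert (Hi : shock_wave Rg gamma tau mu kappa l s i) by (split; auto).
assert (HR : Rabs (rate l s i - A) <= Rmax C1 C3 * eps).
  assert (E : Rabs (strength l i) = eps) by now apply Rabs_pos_eq, Rlt_le.
  destruct s.
  - apply Rle_trans with (C1 * eps).
      rewrite <- E; apply H1; auto; apply Rlt_le_trans with (1 := Heps), Rmin_l.
    apply Rmult_le_compat_r; [lra | apply Rmax_l].
  - apply Rle_trans with (C3 * eps).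
      rewrite <- E; apply H3; auto; apply Rlt_le_trans with (1 := Heps), Rmin_r.
    apply Rmult_le_compat_r; [lra | apply Rmax_r].
pose proof (vol_jump _ _ _ _ _ _ _ i Hi) as [EV _].
pose proof (vol_between _ _ _ _ _ _ _ i Hi) as HV.
change (strength l i) with eps in EV, HV.
change (right i) with r in EV; change (vf i) with (v xi) in HV.
destruct (profile_derivable _ _ _ _ _ _ _ _ _ _ _ Hp xi) as [[Hv _] _].
assert (Hdy : Derive y xi = family_sign s * Derive v xi / eps).
  apply is_derive_unique; unfold y, normalized_volume; auto_derive; auto.
  rewrite (Derive_ext (fun x => v x) v) by reflexivity; field; lra.
assert (Ey : 1 / (y xi * (1 - y xi)) * Derive y xi = rate l s i * eps).
  rewrite Hdy; unfold y, normalized_volume, rate.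
  change (vf i) with (v xi); change (Gf i) with (Derive v xi); change (right i) with r.
  replace (vol r - v xi) with (family_sign s * eps - (v xi - vol l)) by lra.
  destruct s; simpl in HV |- *; field; lra.
rewrite Ey, <- Rmult_minus_distr_r, Rabs_mult, (Rabs_pos_eq eps) by lra.
replace (Rmax C1 C3 * eps ^ 2) with (Rmax C1 C3 * eps * eps) by ring.
apply Rmult_le_compat_r; lra.
Qed.
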